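(* The covering number of the group $L_5(3)$ is $\sigma(L_5(3)) = 393031475$.
   Context: A finite cover of a group $G$ is a finite collection $\mathcal{C}$ of proper subgroups of $G$ with $\bigcup \mathcal{C} = G$. If $G$ admits a finite cover, the covering number $\sigma(G)$ is the smallest cardinality of a finite cover of $G$. Here $L_5(3) = PSL_5(3)$ denotes the projective special linear group of degree $5$ over the field with $3$ elements. *)

(* Defs.v *)
From mathcomp Require Import all_boot all_order all_algebra all_fingroup.
From mathcomp Require Import all_solvable.

Set Implicit Arguments.
Unset Strict Implicit.
Unset Printing Implicit Defensive.

Import GroupScope GRing.Theory.

Section Covering.

Variables (gT : finGroupType) (G : {group gT}).

Definition is_cover (C : {set {group gT}}) : Prop :=
  (forall H : {group gT}, H \in C -> H \proper G)
  /\ \bigcup_(H in C) H = G :> {set gT}.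

(* Since a group need not admit a finite cover (cyclic groups do not), the
   covering number is given by its graph: sigma(G) is defined and equals n. *)
Definition has_covering_number (n : nat) : Prop :=
  (exists C, is_cover C /\ #|C| = n)
  /\ (forall C, is_cover C -> n <= #|C|).

End Covering.

Section SpecialLinear.

(* {'GL_n[F]} consists of matrices of size n.-1.+1, so n is meant to be
   positive. *)
Variables (n : nat) (F : finFieldType).

Definition SLset : {set {'GL_n[F]}} := [set g | (\det (GLval g) == 1)%R].

Lemma SL_group_set : group_set SLset.
Proof.
apply/group_setP; split=> [|g h]; rewrite !inE ?GL_1E ?det1 //.
by move=> /eqP detg /eqP deth; rewrite GL_ME det_mulmx detg deth mulr1.
Qed.

Definition SL : {group {'GL_n[F]}} := Group SL_group_set.

Definition PSL := (SL / 'Z(SL))%G.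

End SpecialLinear.

(* Main.v *)
Require Import Defs.
From HB Require Import structures.
From mathcomp Require Import all_boot all_order all_algebra all_fingroup.
From mathcomp Require Import all_solvable all_field all_character.
From mathcomp Require Import zify.
From Stdlib Require DecimalNat.

Set Implicit Arguments.
Unset Strict Implicit.
Unset Printing Implicit Defensive.

Import GroupScope GRing.Theory.

(** The centre of SL_5(3) is trivial, so L_5(3) is isomorphic to G = SL_5(3)
    (SL_isog_PSL), a group of order 2^9 3^10 5 11^2 13 acting on row vectors
    over F_3. The covering number is the sum of the numbers of conjugates of
    three maximal subgroups: 2^9 3^10 13 normalisers of Sylow 11-subgroups, 121
    stabilisers of points and 1210 stabilisers of subspaces of rank 2.

    These subgroups cover G (element_types, cover_exists). An element whose
    order is divisible by 11 lies in a Sylow 11-subgroup, which is the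
    centraliser of each of its nontrivial subgroups. In the other cases, an
    element of order 13, 5 or 3 in the cyclic group generated by g provides a
    g-invariant subspace of rank 1 or 2, and a 2-element fixes a point because
    the number of points is odd.

    For the lower bound (cover_lower_bound), three conjugacy classes are
    considered: that of a generator of a Sylow 11-subgroup, and those of two
    elements of even order acting irreducibly on the summands of a
    decomposition of the space as 4 + 1, respectively 2 + 3. Each proper
    subgroup that contains such an element x lies in a subgroup M of large
    index such that x belongs to one conjugate of M only; a counting argument
    then bounds from below the number of members of a cover that meet the class
    of x (cover_class_lower_bound). No proper subgroup meets two of the classes,
    so the three bounds add up.

    That argument needs the proper overgroups of the three elements, which are
    found without the classification of the maximal subgroups of G.

    - A proper overgroup H of a Sylow 11-subgroup P normalises P (over_Sylow11).
      Distinct conjugates of P meet trivially, so the number of those in H is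
      congruent to 1 modulo 121; only a few divisors of the order of G are
      (divisors_1_mod_121). If P is its own normaliser in H, then H is a
      Frobenius group with complement P, which forces H = P
      (self_normalising_Sylow11). If the number of conjugates is a power of 3,
      the stabiliser in H of a hyperplane is too large (overgroup_not_odd).
      Otherwise H contains a full Sylow 2-subgroup of G, hence, for each
      hyperplane, an involution that is -1 on the hyperplane and fixes a vector
      outside it. A map from hyperplanes to points off them cannot behave as a
      polarity (no_anisotropic_polarity), so that two of these involutions
      produce a transvection; then H contains all transvections, and its order
      is that of G (overgroup_even).

    - Let x be one of the other two elements and H a proper overgroup of x. Up
      to sign, the powers of x act on the two summands as independent Singer
      cycles (two_block_element). So if H fixes neither summand, then H and -1
      generate a group that is transitive on the 242 nonzero vectors
      (two_block_transitive); hence 121 divides the order of H, which has even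
      order and is G by the previous point (dvd121_even_full). *)

Lemma prime_part_mul p e m : prime p -> ~~ (p %| m) -> ((p ^ e * m)`_p = p ^ e)%N.
Proof.
move=> pr_p nm; have p_gt0 := prime_gt0 pr_p.
have m_gt0 : 0 < m by case: m nm; rewrite ?dvdn0.
have pe_gt0 : 0 < (p ^ e)%N by rewrite expn_gt0 p_gt0.
rewrite (partnM p pe_gt0 m_gt0) part_pnat_id ?pnatX ?pnat_id //.
by rewrite part_p'nat ?muln1 // p'natE.
Qed.

(** * Covers of a finite group *)

Lemma is_cover_isog (gT rT : finGroupType) (G : {group gT}) (K : {group rT}) C :
    G \isog K -> is_cover G C ->
  exists2 C' : {set {group rT}}, is_cover K C' & #|C'| = #|C|.
Proof.
case/isogP=> f injf defK [propC covC].
have sub H : H \in C -> H \subset G by move/propC; apply: proper_sub.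
exists [set (f @* H)%G | H : {group gT} in C]; last first.
  apply: card_in_imset => H1 H2 C1 C2 /(congr1 val) /= eqf.
  by apply/val_inj/(injm_morphim_inj injf _ _ eqf); apply: sub.
split.
  move=> _ /imsetP[H CH ->] /=; rewrite -defK properEcard.
  by rewrite morphimS ?(sub H) //= !card_injm ?(sub H) ?proper_card ?propC.
apply/setP/subset_eqP/andP; split.
  by apply/bigcupsP=> _ /imsetP[H CH ->] /=; rewrite -defK morphimS ?sub.
apply/subsetP=> y; rewrite -defK => /morphimP[x Gx] /[dup].
rewrite -{1}covC => /bigcupP[H CH Hx] _ ->.
apply/bigcupP; exists (f @* H)%G => /=.
  exact: imset_f.
exact: mem_morphim.
Qed.

Lemma has_covering_number_isog (gT rT : finGroupType) (G : {group gT})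
    (K : {group rT}) n :
  G \isog K -> has_covering_number G n -> has_covering_number K n.
Proof.
move=> isoGK [[C [covC <-]] minC]; split.
  by have [C' covC' cardC'] := is_cover_isog isoGK covC; exists C'.
move=> C' covC'; rewrite isog_sym in isoGK.
by have [C1 covC1 <-] := is_cover_isog isoGK covC'; apply: minC.
Qed.

Section Covers.

Variable gT : finGroupType.
Implicit Types (G H M : {group gT}) (x : gT) (C : {set {group gT}}).

(** The pairs formed by an element of x ^: G in M and a coset of M embed in
    x ^: G, because each element of the class lies in a single conjugate
    of M. *)
Lemma card_class_unique_conjugate G M x :
    M \subset G -> x \in G -> {in G, forall g, x \in M :^ g -> g \in M} ->
  #|x ^: G :&: M| * #|G : M| <= #|x ^: G|.
Proof.
move=> sMG Gx uniqM; rewrite -cardsX.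
pose f (u : gT * {set gT}) := u.1 ^ repr u.2.
have reprP c : c \in rcosets M G -> repr c \in G /\ c = M :* repr c.
  case/rcosetsP=> g Gg ->; case: repr_rcosetP => m Mm.
  split; first by rewrite groupM // (subsetP sMG).
  by apply/rcoset_eqP; rewrite mem_rcoset invMg mulKVg groupV.
have injf : {in setX (x ^: G :&: M) (rcosets M G) &, injective f}.
  move=> [y c] [y' c'] /=; rewrite !inE /=.
  case/andP=> /andP[/imsetP[a Ga ->] Ma] /reprP[Gg defc].
  case/andP=> /andP[_ My'] /reprP[Gg' defc']; rewrite /f /=.
  set g := repr c in Gg defc *; set g' := repr c' in Gg' defc' *.
  move=> eq_f.
  have Ma' : a^-1 \in M by apply: uniqM; rewrite ?groupV // mem_conjg invgK.
  have Mg : g * g'^-1 \in M.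
    have eqy' : y' = x ^ (a * (g * g'^-1)).
      by rewrite !conjgM eq_f conjgK.
    have : (a * (g * g'^-1))^-1 \in M.
      apply: uniqM; first by rewrite groupV !(groupM, groupV).
      by rewrite mem_conjg invgK -eqy'.
    by rewrite groupV groupMl // -groupV.
  have eqc : c = c'.
    by rewrite defc defc'; apply/rcoset_eqP; rewrite mem_rcoset.
  by move: eq_f; rewrite /g /g' eqc => /conjg_inj ->.
rewrite -(card_in_imset injf); apply/subset_leq_card/subsetP=> _ /imsetP[[y c] + ->].
rewrite !inE /= => /andP[/andP[/imsetP[a Ga ->] _] /reprP[Gg _]].
by rewrite /f -conjgM imset_f ?groupM.
Qed.

(** Summing the previous bound over the members of C that meet x ^: G: they
    cover the class, and each contains at most a fraction 1/m of it. *)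
Lemma cover_class_lower_bound G C x m :
    is_cover G C -> x \in G ->
    (forall H, H \proper G -> x \in H ->
      exists M : {group gT}, [/\ H \subset M, M \subset G, m <= #|G : M|
        & {in G, forall g, x \in M :^ g -> g \in M}]) ->
  m <= #|[set H in C | x ^: G :&: H != set0]|.
Proof.
move=> [propC covC] Gx hypM; set CX := [set H in C | _].
have X_gt0 : 0 < #|x ^: G| by apply/card_gt0P; exists x; apply: class_refl.
rewrite -(leq_pmul2r X_gt0).
have leXH (H : {group gT}) : H \in CX -> m * #|x ^: G :&: H| <= #|x ^: G|.
  rewrite !inE => /andP[/propC ltHG /set0Pn[_ /setIP[/imsetP[g Gg ->] Hxg]]].
  have [||M [sHM sMG leM uniqM]] := hypM (H :^ g^-1)%G.
  - by rewrite -(conjGid (groupVr Gg)) /= properJ.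
  - by rewrite mem_conjgV.
  apply: leq_trans (card_class_unique_conjugate sMG Gx uniqM).
  rewrite mulnC leq_mul // -(cardJg _ g^-1) conjIg subset_leq_card //.
  by rewrite (classGidr x) ?groupV // setIS.
have leX : #|x ^: G| <= \sum_(H in CX) #|x ^: G :&: H|.
  apply: (@leq_trans #|\bigcup_(H in CX) (x ^: G :&: H)|).
    apply/subset_leq_card/subsetP=> y Xy.
    have Gy : y \in G by apply: subsetP Xy; rewrite class_subG.
    move: (Gy); rewrite -{1}covC => /bigcupP[H CH Hy].
    apply/bigcupP; exists H; rewrite ?inE ?CH ?Xy //=.
    by apply/set0Pn; exists y; rewrite inE Xy.
  elim/big_ind2: _ => [|m1 A m2 B leA leB|//]; first by rewrite cards0.
  exact: leq_trans (leq_card_setU A B).1 (leq_add leA leB).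
apply: leq_trans (leq_mul (leqnn m) leX) _; rewrite big_distrr /=.
apply: (@leq_trans (\sum_(H in CX) #|x ^: G|)); first exact: leq_sum.
by rewrite sum_nat_const.
Qed.

End Covers.

(** The Sylow subgroup acts by conjugation on its other conjugates, and
    semiregularly because it meets them trivially. *)
Lemma card_conjugates_TI_Sylow (gT : finGroupType) (p : nat) (H P : {group gT}) :
    p.-Sylow(H) P ->
    {in H, forall g, P :&: P :^ g != 1 -> P :^ g = P} ->
  #|H : 'N_H(P)| = 1 %[mod #|P|].
Proof.
move=> sylP tiP; have [sPH pP _] := and3P sylP.
rewrite -card_conjugates (cardsD1 (gval P)) orbit_refl; set S := _ :\ _.
have actsS : [acts P, on S | 'Js].
  apply/actsP=> a Pa B; rewrite !inE /=; congr (~~ _ && _).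
    by rewrite -{1}(conjGid Pa) (inj_eq (@conjsg_inj _ a)).
  by apply: (actsP (acts_orbit 'Js (gval P) (subsetT H))); apply: (subsetP sPH).
rewrite -(acts_sum_card_orbit actsS).
rewrite (eq_bigr (fun=> #|P|)) => [|_ /imsetP[B SB ->]].
  by rewrite sum_nat_const addnC modnMDl.
have /setD1P[neqB /imsetP[g Hg defB]] := SB.
rewrite card_orbit (_ : 'C_P[B | 'Js] = 1) ?indexg1 //.
have tiPB : P :&: B = 1.
  apply/eqP; apply: contraNT neqB; rewrite defB => /(tiP g Hg) defP.
  by rewrite /= defP.
apply/trivgP/subsetP=> a /setIP[Pa /astab1P /= nBa].
rewrite -tiPB inE Pa defB /=.
have sPgN : P :^ g \subset 'N_H(P :^ g).
  by rewrite subsetI normG -(conjGid Hg) conjSg sPH.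
have sylB : p.-Sylow('N_H(P :^ g)) (P :^ g).
  by apply: pHall_subl sPgN (subsetIl _ _) _; rewrite pHallJ.
rewrite -cycle_subG (sub_normal_Hall sylB) ?(pgroupS _ pP) ?cycle_subG //.
  by rewrite /normal sPgN subsetIr.
by rewrite inE (subsetP sPH) //= -defB; apply/normP.
Qed.

(** * Linear groups acting on row vectors *)

(** GL_n(F) with an opaque carrier: unification then never unfolds the group
    operations of {'GL_n[F]} down to matrix products. *)
Record linear_group (F : finFieldType) (n : nat) := LinearGroup {
  carrier :> finGroupType;
  mx : carrier -> 'M[F]_n;
  mxM : {morph mx : g h / g * h >-> (g *m h)%R};
  mx_inj : injective mx;
  mx_unit : forall g, mx g \in unitmx;
  mx_onto : forall A, A \in unitmx -> exists g, mx g = A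
}.

Section RowAction.

Local Open Scope ring_scope.

Variables (F : finFieldType) (n : nat) (L : linear_group F n).
Implicit Types (g h : L) (R : {group L}).

Lemma mx1 : mx (1%g : L) = 1%:M.
Proof.
have := mxM (1%g : L) 1%g; rewrite mulg1 => e1.
by rewrite -[LHS](mulKmx (mx_unit (1%g : L))) -e1 mulVmx ?mx_unit.
Qed.

Lemma mx_free g : row_free (mx g). Proof. by rewrite row_free_unit mx_unit. Qed.

Definition rowact (v : 'rV[F]_n) g := v *m mx g.

Fact rowact_is_action : is_action setT rowact.
Proof.
apply: is_total_action => [v | v g h]; first by rewrite /rowact mx1 mulmx1.
by rewrite /rowact mxM mulmxA.
Qed.

Canonical row_action := Action rowact_is_action.

Definition stab m (W : 'M[F]_(m, n)) : {set L} := [set g | (W *m mx g <= W)%MS].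

Lemma stabP m (W : 'M[F]_(m, n)) g : reflect (W *m mx g :=: W)%MS (g \in stab W).
Proof.
rewrite inE; apply: (iffP idP) => [sWg | ->//].
apply/eqmxP; rewrite -(geq_leqif (mxrank_leqif_eq sWg)) mxrankMfree //.
exact: mx_free.
Qed.

Fact stab_group_set m (W : 'M[F]_(m, n)) : group_set (stab W).
Proof.
apply/group_setP; split=> [|g h]; first by rewrite inE mx1 mulmx1.
rewrite !inE mxM => sg sh; rewrite mulmxA.
exact: submx_trans (submxMr _ sg) sh.
Qed.
Canonical stab_group m (W : 'M[F]_(m, n)) := Group (stab_group_set W).

Lemma eqmx_stab m1 m2 (W1 : 'M[F]_(m1, n)) (W2 : 'M[F]_(m2, n)) :
  (W1 :=: W2)%MS -> stab W1 = stab W2.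
Proof. by move=> eqW; apply/setP=> g; rewrite !inE eqW (eqmxMr _ eqW). Qed.

Lemma stabJ m (W : 'M[F]_(m, n)) g : stab (W *m mx g) = stab W :^ g.
Proof.
apply/setP=> h; rewrite mem_conjg !inE conjgE invgK !mxM -!mulmxA.
rewrite -(submxMfree _ _ (mx_free g^-1)) -!mulmxA -(mxM g) mulgV mx1.
by rewrite !mulmx1.
Qed.

Definition fixmx (A : {set L}) : 'M[F]_n :=
  (\bigcap_(g in A) kermx (mx g - 1%:M))%MS.

Lemma fixmxP (A : {set L}) m (W : 'M[F]_(m, n)) :
  reflect {in A, forall g, W *m mx g = W} (W <= fixmx A)%MS.
Proof.
apply: (iffP sub_bigcapmxP) => fixW g Ag.
  apply/eqP; rewrite -subr_eq0 -[X in _ - X]mulmx1 -mulmxBr -sub_kermx.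
  exact: fixW.
by apply/sub_kermxP; rewrite mulmxBr mulmx1 fixW // subrr.
Qed.

Lemma fixmx_full (A : {set L}) : row_full (fixmx A) -> A \subset [1 L]%g.
Proof.
rewrite -sub1mx => /fixmxP fixA; apply/subsetP=> g /fixA; rewrite mul1mx inE => g1.
by apply/eqP/mx_inj; rewrite mx1.
Qed.

Lemma sub_kermx_fix_cycle g : (kermx (mx g - 1%:M) <= fixmx <[g]>)%MS.
Proof.
apply/fixmxP=> _ /cycleP[i ->]; elim: i => [|i IHi].
  by rewrite mx1 mulmx1.
rewrite expgSr mxM mulmxA IHi; apply/eqP.
by rewrite -subr_eq0 -[X in _ - X]mulmx1 -mulmxBr mulmx_ker.
Qed.

Lemma fixmx_stab (A : {set L}) : 'N(A)%g \subset stab (fixmx A).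
Proof.
apply/subsetP=> g nAg; rewrite inE; apply/fixmxP=> h Ah.
have Ahg : (h ^ g^-1)%g \in A by rewrite memJ_norm ?groupV.
rewrite -[in RHS](fixmxP _ _ (submx_refl (fixmx A)) _ Ahg) -!mulmxA -!mxM.
by rewrite conjgE invgK !mulgA mulgKV.
Qed.

Lemma stab_acts R m (W : 'M[F]_(m, n)) :
  R \subset stab W -> [acts R, on rowg W | row_action].
Proof.
move=> /subsetP sRW; apply/actsP=> g /sRW/stabP sWg v; rewrite !inE /= /rowact.
by rewrite -sWg submxMfree ?mx_free.
Qed.

(** The orbits of a p-group have p-power length, and the vectors of W that R
    fixes form the subspace W :&: fixmx R. *)
Lemma card_fix_mod (p : nat) R m (W : 'M[F]_(m, n)) :
    p.-group R -> R \subset stab W ->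
  (#|F| ^ \rank W = #|F| ^ \rank (W :&: fixmx R)%MS %[mod p])%N.
Proof.
move=> pR sRW; rewrite -!card_rowg.
rewrite (pgroup_fix_mod pR (stab_acts sRW)); congr (_ %% _)%N.
rewrite rowgI; apply: eq_card => v; rewrite !in_setI; congr (_ && _).
by rewrite mem_rowg; apply/afixP/fixmxP.
Qed.

Definition specg : {set L} := [set g | \det (mx g) == 1].

Fact specg_group_set : group_set specg.
Proof.
apply/group_setP; split=> [|g h]; rewrite !inE ?mx1 ?det1 //.
by rewrite mxM det_mulmx => /eqP-> /eqP->; rewrite mulr1.
Qed.
Canonical specg_group := Group specg_group_set.

End RowAction.

Arguments specg {F n} L.
Arguments specg_group {F n} L.
Arguments stab {F n} L {m} W.

(** * The group SL_5(3) and the fixed spaces of its p-subgroups *)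

Section SL53.

Local Notation F := 'F_3.
Variable L : linear_group F 5.
Local Notation G := (specg_group L).
Implicit Types (H K R : {group L}) (g : L).

Lemma F3_cases (a : F) : [\/ a = 0%R, a = 1%R | a = (-1)%R].
Proof.
by case: a => [[|[|[|//]]] lta]; [constructor 1 | constructor 2 | constructor 3];
  apply: val_inj.
Qed.

Lemma neg1_exists : exists z : L, mx z == ((-1)%:M)%R.
Proof.
have [|z zE] := @mx_onto _ _ L ((-1)%:M)%R; last by exists z; apply/eqP.
by rewrite unitmxE det_scalar unitrX // unitrN1.
Qed.

Definition neg1 : L := xchoose neg1_exists.

Lemma neg1E : mx neg1 = (-1)%:M%R.
Proof. by apply/eqP; apply: xchooseP neg1_exists. Qed.

Lemma neg1_central g : commute neg1 g.
Proof. by apply: mx_inj; rewrite !mxM neg1E scalar_mxC. Qed.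

Lemma neg1_order : #[neg1] = 2.
Proof.
apply: nt_prime_order => //.
  by apply: mx_inj; rewrite expgS expg1 mxM neg1E -scalar_mxM mulrNN mulr1 mx1.
apply/eqP=> /(congr1 (fun g => mx g ord0 ord0)).
by rewrite neg1E mx1 !mxE.
Qed.

Lemma det_neg1 g : (\det (mx (neg1 * g)%g) = - \det (mx g))%R.
Proof.
rewrite mxM det_mulmx neg1E det_scalar -[(_ ^+ 5)%R]signr_odd expr1.
by rewrite mulN1r.
Qed.

Lemma det_neq0 g : (\det (mx g) != 0)%R.
Proof. by have := mx_unit g; rewrite unitmxE unitfE. Qed.

(** In odd dimension, -1 has determinant -1, so GL_5(3) is the direct product
    of SL_5(3) and {1, -1}. *)
Lemma SL_neg1 g : (g \in G) || (neg1 * g \in G).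
Proof.
have := det_neq0 g; rewrite !inE det_neg1.
by case: (F3_cases (\det (mx g))%R) => ->; rewrite ?eqxx ?opprK ?eqxx ?orbT.
Qed.

Lemma card_SL_cap K : neg1 \in K -> #|K| = (2 * #|K :&: G|)%N.
Proof.
move=> Kz; rewrite -(cardsID G K) mul2n -addnn; congr (_ + _)%N.
rewrite -[RHS](card_lcoset _ neg1); apply: eq_card => g.
rewrite mem_lcoset in_setD in_setI groupMl ?groupV // andbC; congr (_ && _).
have := det_neg1 (neg1^-1 * g)%g; rewrite mulKVg !inE => ->.
have := det_neq0 (neg1^-1 * g).
by case: (F3_cases (\det (mx (neg1^-1 * g)))%R) => ->; rewrite ?opprK.
Qed.

Lemma neg1_stab m (W : 'M[F]_(m, 5)) : neg1 \in stab L W.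
Proof. by rewrite inE neg1E mul_mx_scalar scalemx_sub. Qed.

(** The orders of 3 modulo 11, 5 and 13 are 5, 4 and 3; they bound the ranks of
    the fixed spaces of the elements of these orders. *)
Lemma exp3_mod11 k d : k <= 5 -> d <= 5 -> (3 ^ k = 3 ^ d %[mod 11])%N ->
  (k = d \/ k + d = 5 /\ k * d = 0)%N.
Proof.
case: k => [|[|[|[|[|[|k]]]]]] //;
  case: d => [|[|[|[|[|[|d]]]]]] // _ _; by [left | right | discriminate].
Qed.

Lemma exp3_mod5 k d : k <= 5 -> d <= 5 -> (3 ^ k = 3 ^ d %[mod 5])%N ->
  (k = d %[mod 4])%N.
Proof. by case: k => [|[|[|[|[|[|k]]]]]] //;
   case: d => [|[|[|[|[|[|d]]]]]] // _ _. Qed.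

Lemma exp3_mod13 k d : k <= 5 -> d <= 5 -> (3 ^ k = 3 ^ d %[mod 13])%N ->
  (k = d %[mod 3])%N.
Proof. by case: k => [|[|[|[|[|[|k]]]]]] //;
   case: d => [|[|[|[|[|[|d]]]]]] // _ _. Qed.

Lemma rank_le5 m (W : 'M[F]_(m, 5)) : \rank W <= 5.
Proof. exact: rank_leq_col. Qed.

Lemma stab_full R : R \subset stab L (1%:M : 'M[F]_5)%R.
Proof. by apply/subsetP=> g _; rewrite inE submx1. Qed.

Lemma rank_fix_mod (p : nat) R : p.-group R ->
  (3 ^ 5 = 3 ^ \rank (fixmx R) %[mod p])%N.
Proof.
move=> pR; have := card_fix_mod pR (stab_full R).
by rewrite mxrank1 cap1mx card_ord.
Qed.

Lemma rank_fix_lt5 R : R :!=: 1 -> \rank (fixmx R) < 5.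
Proof.
move=> ntR; rewrite ltn_neqAle rank_le5 andbT; apply: contraNneq ntR => fullR.
by rewrite -subG1; apply: fixmx_full; rewrite /row_full fullR.
Qed.

Lemma rank_fix11 R : 11.-group R -> R :!=: 1 -> \rank (fixmx R) = 0.
Proof.
move=> pR ntR; have lt5 := rank_fix_lt5 ntR.
by have [//| |[]] := exp3_mod11 _ (ltnW lt5) (rank_fix_mod pR); lia.
Qed.

(** 11-subgroups are irreducible: 3 has order 5 modulo 11. *)
Lemma irr11 R m (W : 'M[F]_(m, 5)) : 11.-group R -> R :!=: 1 ->
  R \subset stab L W -> \rank W = 0 \/ \rank W = 5.
Proof.
move=> pR ntR sRW; have := card_fix_mod pR sRW; rewrite card_ord.
have -> : \rank (W :&: fixmx R)%MS = 0.
  have := mxrankS (capmxSr W (fixmx R)); rewrite (rank_fix11 pR ntR); lia.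
by case/(exp3_mod11 (rank_le5 W)) => //; lia.
Qed.

Lemma rank_fix5 R : 5.-group R -> R :!=: 1 -> \rank (fixmx R) = 1%N.
Proof.
move=> pR ntR; have lt5 := rank_fix_lt5 ntR.
have /= := exp3_mod5 _ (ltnW lt5) (rank_fix_mod pR); lia.
Qed.

Lemma rank_fix13 R : 13.-group R -> R :!=: 1 -> \rank (fixmx R) = 2.
Proof.
move=> pR ntR; have lt5 := rank_fix_lt5 ntR.
have /= := exp3_mod13 _ (ltnW lt5) (rank_fix_mod pR); lia.
Qed.

Lemma rank_fix3 R : 3.-group R -> 0 < \rank (fixmx R).
Proof.
move=> pR; have := rank_fix_mod pR; case: (\rank _) => //.
Qed.

End SL53.

(** * Order of the general linear group *)
Section Orders.

Fact GL_linear_group_mxM (F : finFieldType) n :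
  {morph (fun g : {'GL_n.+1[F]} => GLval g : 'M[F]_n.+1)
    : g h / g * h >-> (g *m h)%R}.
Proof. by []. Qed.

Fact GL_linear_group_onto (F : finFieldType) n (A : 'M[F]_n.+1) :
  A \in unitmx -> exists g : {'GL_n.+1[F]}, GLval g = A.
Proof. by move=> uA; exists (FinRing.Unit uA). Qed.

Definition GL_linear_group (F : finFieldType) n : linear_group F n.+1 :=
  LinearGroup (@GL_linear_group_mxM F n) val_inj (@GL_unitmx _ _)
    (@GL_linear_group_onto F n).

Lemma card_linear_group_unitmx (F : finFieldType) n (L : linear_group F n) :
  #|L| = #|[set A : 'M[F]_n | A \in unitmx]|.
Proof.
rewrite -cardsT -(card_imset _ (@mx_inj _ _ L)); apply: eq_card => A.
rewrite inE; apply/imsetP/idP=> [[g _ ->] | /(@mx_onto _ _ L)[g <-]].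
  exact: mx_unit.
by exists g; rewrite ?inE.
Qed.

Lemma card_unitmx (F : finFieldType) n :
  #|[set A : 'M[F]_n.+1 | A \in unitmx]|
    = (#|F| ^ 'C(n.+1, 2) * \prod_(1 <= i < n.+2) (#|F| ^ i - 1))%N.
Proof.
by rewrite -(card_linear_group_unitmx (GL_linear_group F n)) -card_GL // cardsT.
Qed.

End Orders.

(** * Sylow 11-subgroups *)
Section SylowEleven.

Local Notation F := 'F_3.
Variable L : linear_group F 5.
Local Notation G := (specg_group L).
Implicit Types (H K R P Q : {group L}) (g : L).

Lemma card_SL53 : #|G| = (11 ^ 2 * (2 ^ 9 * 3 ^ 10 * 5 * 13))%N.
Proof.
have := card_SL_cap (in_setT (neg1 L)); rewrite setTI cardsT.
rewrite card_linear_group_unitmx card_unitmx.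
have -> : #|F| = 3 by rewrite card_ord.
have -> : 'C(5, 2) = 10 by [].
do 5![rewrite big_ltn; last by []]; rewrite big_geq; last by []; lia.
Qed.

Lemma card_Sylow11 P : 11.-Sylow(G) P -> #|P| = (11 ^ 2)%N.
Proof.
move=> sylP; rewrite (card_Hall sylP) card_SL53.
apply: prime_part_mul; first by [].
by rewrite !Euclid_dvdM ?Euclid_dvdX.
Qed.

Lemma abelian_Sylow11 P : 11.-Sylow(G) P -> abelian P.
Proof.
move=> sylP; apply: (p2group_abelian (pHall_pgroup sylP)).
by rewrite (card_Sylow11 sylP) pfactorK.
Qed.

Lemma kermx_full m n (A : 'M[F]_(m, n)) : row_full (kermx A) -> A = 0%R.
Proof. by rewrite -sub1mx => /sub_kermxP; rewrite mul1mx. Qed.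

(** As R is irreducible, an element of its centraliser is determined by the
    image of a single nonzero vector. *)
Lemma card_cent11 R : 11.-group R -> R :!=: 1 -> #|'C(R)| <= 242.
Proof.
move=> pR ntR; pose e0 : 'rV[F]_5 := delta_mx 0%R 0%R.
have nz_e0 : e0 != 0%R by apply/eqP => /rowP/(_ 0%R)/eqP; rewrite !mxE !eqxx.
have inj_e0 : {in 'C(R) &, injective (fun g => e0 *m mx g)%R}.
  move=> g h /centP cg /centP ch eq_gh; set D := (mx g - mx h)%R.
  have sRD : R \subset stab L (kermx D).
    apply/subsetP=> r Rr; rewrite inE; apply/sub_kermxP.
    rewrite -mulmxA mulmxBr -!mxM -cg // -ch // !mxM -mulmxBl mulmxA mulmx_ker.
    by rewrite mul0mx.
  have sub_e0 : (e0 <= kermx D)%MS.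
    by apply/sub_kermxP; rewrite mulmxBr; apply/eqP; rewrite subr_eq0 eq_gh.
  have [/eqP|full] := irr11 pR ntR sRD.
    by rewrite mxrank_eq0 => /eqP D0; move: sub_e0; rewrite D0 submx0 (negPf nz_e0).
  apply/mx_inj/eqP; rewrite -subr_eq0 -/D; apply/eqP/kermx_full.
  by rewrite /row_full full.
rewrite -(card_in_imset inj_e0).
apply: (@leq_trans #|[set~ (0 : 'rV[F]_5)%R]|).
  apply/subset_leq_card/subsetP=> _ /imsetP[g _ ->]; rewrite !inE.
  by rewrite -(mul0mx _ (mx g)) (inj_eq (row_free_inj (mx_free g))).
by rewrite cardsC1 card_mx card_ord.
Qed.

(** The centraliser of R in GL_5(3) has at most 242 elements and contains -1,
    so at most half of them have determinant 1. *)
Lemma cent_Sylow11 P R :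
  11.-Sylow(G) P -> R \subset P -> R :!=: 1 -> 'C_G(R) = P.
Proof.
move=> sylP sRP ntR; have [sPG pP _] := and3P sylP.
apply/esym/eqP; rewrite eqEcard subsetI sPG (card_Sylow11 sylP).
rewrite (subset_trans (abelian_Sylow11 sylP) (centS sRP)) /=.
have Cz : neg1 L \in 'C(R) by apply/centP=> r _; apply: neg1_central.
have := card_cent11 (pgroupS sRP pP) ntR.
by rewrite (card_SL_cap Cz) setIC -[242]/(2 * 121)%N leq_pmul2l.
Qed.

(** Both groups are the centraliser of their intersection. *)
Lemma TI_Sylow11 P Q : 11.-Sylow(G) P -> 11.-Sylow(G) Q ->
  P :&: Q != 1 -> P :=: Q.
Proof.
move=> sylP sylQ ntPQ.
have <- := @cent_Sylow11 P (P :&: Q)%G sylP (subsetIl _ _) ntPQ.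
exact: (@cent_Sylow11 Q (P :&: Q)%G sylQ (subsetIr _ _) ntPQ).
Qed.

Lemma unit_sub1_11 g : 11.-elt g -> g != 1 -> (mx g - 1%:M)%R \in unitmx.
Proof.
move=> pg ntg; rewrite -row_free_unit -kermx_eq0 -mxrank_eq0 -leqn0.
apply: leq_trans (mxrankS (sub_kermx_fix_cycle g)) _.
by rewrite rank_fix11 ?cycle_eq1.
Qed.

(** The differences between distinct elements of P are invertible, as the
    nontrivial elements of P fix no nonzero vector. *)
Lemma cyclic_Sylow11 P : 11.-Sylow(G) P -> cyclic P.
Proof.
move=> sylP; have pP := pHall_pgroup sylP.
apply: (@div_ring_mul_group_cyclic _ P 'M[F]_5 (@mx _ _ L)).
- exact: mx1.
- by move=> g h _ _; apply: mxM.
- move=> g /setD1P[ntg Pg]; apply: unit_sub1_11 => //.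
  exact: mem_p_elt pP Pg.
- exact: abelian_Sylow11.
Qed.

Lemma Sylow11_neq1 P : 11.-Sylow(G) P -> P :!=: 1.
Proof. by move=> sylP; rewrite -cardG_gt1 (card_Sylow11 sylP). Qed.

Lemma conjugates_mod121 H P : H \subset G -> P \subset H -> 11.-Sylow(G) P ->
  (#|H : 'N_H(P)| = 1 %[mod 121])%N.
Proof.
move=> sHG sPH sylP; rewrite -[121]/(11 ^ 2)%N -(card_Sylow11 sylP).
apply: card_conjugates_TI_Sylow (pHall_subl sPH sHG sylP) _ => g Hg ntI.
by apply/esym/(TI_Sylow11 sylP) => //; rewrite pHallJ // (subsetP sHG).
Qed.

(** The quotient of the normaliser by P = C_G(P) embeds in Aut P. *)
Lemma index_norm_dvd110 P : 11.-Sylow(G) P -> #|'N_G(P) : P| %| 110.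
Proof.
move=> sylP; have cycP := cyclic_Sylow11 sylP.
have <- : totient #|P| = 110 by rewrite (card_Sylow11 sylP) totient_pfactor.
rewrite -(card_Aut_cyclic cycP).
have <- : #|conj_aut P @* 'N_G(P)| = #|'N_G(P) : P|.
  rewrite card_morphim ker_conj_aut (setIidPr (subsetIr G 'N(P))) -indexgI.
  rewrite -setIA (setIidPr (cent_sub P)).
  by rewrite (cent_Sylow11 sylP) ?Sylow11_neq1.
by rewrite cardSg // Aut_conj_aut.
Qed.

(** Among the divisors of 110, only 5 is a value of the index of P in its
    normaliser for which the number of conjugates of P is 1 modulo 121. *)
Lemma card_norm_Sylow11 P : 11.-Sylow(G) P ->
  #|'N_G(P)| = (11 ^ 2 * 5)%N /\ #|G : 'N_G(P)| = (2 ^ 9 * 3 ^ 10 * 13)%N.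
Proof.
move=> sylP; have sPG := pHall_sub sylP.
have sPN : P \subset 'N_G(P) by rewrite subsetI sPG normG.
have := conjugates_mod121 (subxx G) sPG sylP.
have := card_SL53; rewrite -(Lagrange (subsetIl G 'N(P))) -(Lagrange sPN).
rewrite (card_Sylow11 sylP).
have : #|'N_G(P) : P| \in divisors 110 by rewrite -dvdn_divisors ?index_norm_dvd110.
move: #|'N_G(P) : P| #|G : 'N_G(P)| => k n.
have -> : divisors 110 = [:: 1; 2; 5; 10; 11; 22; 55; 110]%N by [].
rewrite !inE => /or4P[|||/or4P[|||/orP[]]] /eqP->; lia.
Qed.

End SylowEleven.

(** * Divisors congruent to 1 modulo 121 *)
Section Divisors.

Local Open Scope nat_scope.

Lemma dvdn_prime_power_mul p e m n : prime p -> ~~ (p %| m) -> 0 < m ->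
  n %| p ^ e * m -> exists i n', [/\ n = p ^ i * n', i <= e & n' %| m].
Proof.
move=> pr_p nm m_gt0 dv_n; have p_gt0 := prime_gt0 pr_p.
have n_gt0 : 0 < n by apply: dvdn_gt0 dv_n; rewrite muln_gt0 expn_gt0 p_gt0.
have [n' co_n' def_n] := pfactor_coprime pr_p n_gt0.
exists (logn p n), n'; split; first by rewrite {1}def_n mulnC.
  have := dvdn_leq_log p _ dv_n; rewrite muln_gt0 expn_gt0 p_gt0 m_gt0 => /(_ isT).
  by rewrite mulnC logn_Gauss ?pfactorK // prime_coprime.
rewrite -(@Gauss_dvdr n' (p ^ e)); first last.
  by rewrite coprime_sym coprimeXl.
by apply: dvdn_trans dv_n; rewrite def_n dvdn_mulr.
Qed.

(** Reduction at each step keeps the numbers small in the finite check below. *)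
Definition modpow p i := iter i (fun x => p * x %% 121) 1.

Lemma modpowE p i : p ^ i = modpow p i %[mod 121].
Proof.
elim: i => //= i IHi; rewrite expnS modn_mod -modnMmr IHi modnMmr //.
Qed.

Lemma eqn_modM d a b a' b' :
  a = a' %[mod d] -> b = b' %[mod d] -> a * b = a' * b' %[mod d].
Proof. by move=> eq_a eq_b; rewrite -modnMm eq_a eq_b modnMm. Qed.

(** A finite check over the exponents of 2, 3, 5 and 13. The cases reflect that
    3^5 and 2^9 13 are both congruent to 1 modulo 121. *)
Lemma divisors_1_mod_121 n :
    n %| 2 ^ 9 * 3 ^ 10 * 5 * 13 -> n = 1 %[mod 121] ->
  [\/ exists2 i, i <= 2 & n = 3 ^ (5 * i),
      exists2 i, i <= 2 & n = 2 ^ 9 * 13 * 3 ^ (5 * i)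
    | exists2 m, n = 5 * 13 * m & ~~ (13 %| m)].
Proof.
have -> : 2 ^ 9 * 3 ^ 10 * 5 * 13 = 2 ^ 9 * (3 ^ 10 * (5 ^ 1 * (13 ^ 1 * 1))).
  by lia.
move=> dv_n n1.
have [||a [na [def_n le_a dv_na]]] := dvdn_prime_power_mul (isT : prime 2) _ _ dv_n.
- by rewrite !Euclid_dvdM // !Euclid_dvdX.
- by rewrite !muln_gt0 !expn_gt0.
have [||b [nb [def_na le_b dv_nb]]] := dvdn_prime_power_mul (isT : prime 3) _ _ dv_na.
- by rewrite !Euclid_dvdM // !Euclid_dvdX.
- by rewrite !muln_gt0 !expn_gt0.
have [||c [nc [def_nb le_c dv_nc]]] := dvdn_prime_power_mul (isT : prime 5) _ _ dv_nb.
- by [].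
- by [].
have [||d [nd [def_nc le_d]]] := dvdn_prime_power_mul (isT : prime 13) _ _ dv_nc.
- by [].
- by [].
rewrite dvdn1 => /eqP nd1; move: def_n; rewrite def_na def_nb def_nc nd1 => def_n.
have : modpow 2 a * modpow 3 b * modpow 5 c * modpow 13 d = 1 %[mod 121].
  rewrite -n1 def_n muln1 !mulnA.
  by do !apply: eqn_modM; rewrite -modpowE.
have ltS k e : k <= e -> k \in iota 0 e.+1 by rewrite mem_iota.
move=> mod1; move: (def_n) (ltS _ _ le_a) (ltS _ _ le_b) (ltS _ _ le_c) (ltS _ _ le_d).
clear - mod1; move: a b c d mod1.
have : all (fun a => all (fun b => all (fun c => all (fun d =>
    (modpow 2 a * modpow 3 b * modpow 5 c * modpow 13 d == 1 %[mod 121]) ==>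
    ((c == 0) && (5 %| b) && ((a == d * 9)) || (c == 1) && (d == 1)))
  (iota 0 2)) (iota 0 2)) (iota 0 11)) (iota 0 10).
  by vm_compute.
move=> chk a b c d mod1 def_n la b_lt lc d_lt.
move: (allP (allP (allP (allP chk a la) b b_lt) c lc) d d_lt).
rewrite mod1 eqxx implyTb.
clear chk.
case/orP=> [/andP[/andP[/eqP c0 /dvdnP[i def_b]] /eqP def_a] | /andP[/eqP c1 /eqP d1]].
  have le_i : i <= 2 by move: b_lt; rewrite mem_iota def_b; lia.
  rewrite def_n def_a def_b c0 (mulnC i) expn0.
  move: d_lt; rewrite !inE => /orP[] /eqP->; [constructor 1 | constructor 2];
    (exists i; first exact: le_i); rewrite ?mul0n ?mul1n ?expn0 ?expn1; lia.
constructor 3; exists (2 ^ a * 3 ^ b); last first.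
  by rewrite (Euclid_dvdM _ _ (isT : prime 13)) !(Euclid_dvdX _ _ (isT : prime 13)).
rewrite def_n c1 d1 !expn1; lia.
Qed.

End Divisors.

(** * Overgroups of a Sylow 11-subgroup: the orders *)
Section SelfNormalising.

Local Notation F := 'F_3.
Variable L : linear_group F 5.
Local Notation G := (specg_group L).
Implicit Types (H K R P Q : {group L}) (g : L).

(** Otherwise H is a Frobenius group with complement P, since distinct
    conjugates of P meet trivially. The order of its kernel K is congruent to 1
    modulo 121, so it is a power of 3 or divisible by 13 exactly once. If K is a
    3-group, its fixed vectors form a proper nonzero P-invariant subspace,
    contradicting the irreducibility of P. In the other case P normalises some
    Sylow 13-subgroup of K and acts on it without nontrivial fixed points,
    whereas 121 does not divide 12. *)
Lemma self_normalising_Sylow11 H P :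
    11.-Sylow(G) P -> P \subset H -> H \subset G -> 'N_H(P) = P -> H :=: P.
Proof.
move=> sylP sPH sHG defN; apply/eqP; apply: contraT => neqHP.
have pP := pHall_pgroup sylP; have cardP := card_Sylow11 sylP.
have frobHP : [Frobenius H with complement P].
  apply/andP; split; first by rewrite eq_sym.
  apply/normedTI_P; split.
  - by rewrite setD_eq0 subG1 (Sylow11_neq1 sylP).
  - by rewrite -{1}defN normD1.
  - move=> g Hg; rewrite -setI_eq0 conjD1g -setDIl setD_eq0 subG1 => ntI.
    rewrite -defN inE Hg; apply/normP/esym/(TI_Sylow11 sylP ) => //=.
    by rewrite pHallJ // (subsetP sHG).
have [K frobK] := Frobenius_kernel_exists frobHP.
have [/sdprodP[_ defH nKP tiKP] ntK _ ltKH _] := Frobenius_context frobK.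
have cardK : #|H : 'N_H(P)| = #|K|.
  by rewrite defN -divgS // -defH TI_cardMg // mulnK ?cardG_gt0.
have dv_K : #|K| %| 2 ^ 9 * 3 ^ 10 * 5 * 13.
  rewrite -(dvdn_pmul2l (cardG_gt0 P)) -[X in X %| _]mulnC -TI_cardMg // defH.
  by rewrite cardP -(card_SL53 L) cardSg.
have dvd13 m : #|K| = (13 * m)%N -> ~~ (13 %| m) -> false.
  move=> def_cardK n13.
  (* The number of Sylow 13-subgroups of K is prime to 11, so P fixes one. *)
  have actsP : [acts P, on 'Syl_13(K) | 'JG].
    apply/actsP=> a Pa Z; rewrite !inE -{1}(normP (subsetP nKP a Pa)).
    exact: pHallJ2.
  have [Z /setIP[SylZ fixZ]] : exists Z, Z \in 'Fix_('Syl_13(K) | 'JG)(P).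
    apply/set0Pn; apply: contraTneq (Frobenius_coprime frobK) => fix0.
    have := pgroup_fix_mod pP actsP; rewrite fix0 cards0 mod0n => /eqP dv11.
    rewrite cardP coprime_sym coprime_pexpl // prime_coprime // negbK.
    exact: dvdn_trans dv11 (card_Syl_dvd _ _).
  rewrite inE in SylZ; have cardZ : #|Z| = 13.
    by rewrite (card_Hall SylZ) def_cardK -[X in (X * _)%N]expn1 prime_part_mul.
  have ntZ : Z :!=: 1 by rewrite -cardG_gt1 cardZ.
  have nZP : P \subset 'N(Z).
    apply/subsetP=> a Pa; apply/normP.
    by have /(congr1 val) := afixP fixZ a Pa.
  have := Frobenius_dvd_ker1 (Frobenius_subl ntZ (pHall_sub SylZ) nZP frobK).
  by rewrite cardP cardZ.
have mod1 := conjugates_mod121 sHG sPH sylP; rewrite cardK in mod1.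
have [[i _ cardK3] | [i _ cardK13] | [m cardK13 n13]] := divisors_1_mod_121 dv_K mod1.
- have K3 : 3.-group K by rewrite /pgroup cardK3 pnatX.
  have sPN : P \subset stab L (fixmx K) := subset_trans nKP (fixmx_stab K).
  have := rank_fix_lt5 ntK; have := rank_fix3 K3.
  by case: (irr11 pP (Sylow11_neq1 sylP) sPN) => ->.
- apply: (dvd13 (2 ^ 9 * 3 ^ (5 * i))%N); first by clear -cardK13; lia.
  clear; rewrite (Euclid_dvdM _ _ (isT : prime 13)).
  by rewrite !(Euclid_dvdX _ _ (isT : prime 13)).
by apply: (dvd13 (5 * m)%N); [clear -cardK13; lia | rewrite Euclid_dvdM].
Qed.

End SelfNormalising.

Section Hyperplanes.

Local Notation F := 'F_3.
Variable L : linear_group F 5.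
Local Notation G := (specg_group L).
Implicit Types (H K R P Q : {group L}) (g : L) (phi psi : 'cV[F]_5).

(** The index of P in its normaliser in H is 1, which is the self-normalising
    case, or 5. In the latter case the number of conjugates of P in H is prime
    to 5, which leaves the first two cases of divisors_1_mod_121. *)
Lemma card_over_Sylow11 H P :
    11.-Sylow(G) P -> P \subset H -> H \subset G ->
  H \subset 'N(P) \/
  exists2 i, i <= 2 & 0 < i /\ #|H| = (605 * 3 ^ (5 * i))%N
                   \/ #|H| = (605 * (2 ^ 9 * 13 * 3 ^ (5 * i)))%N.
Proof.
move=> sylP sPH sHG; have cardP := card_Sylow11 sylP.
have sPN : P \subset 'N_H(P) by rewrite subsetI sPH normG.
have [cardN cardGN] := card_norm_Sylow11 sylP.
have dvH : #|'N_H(P) : P| %| 5.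
  have sNN : 'N_H(P) \subset 'N_G(P) by apply: setSI.
  rewrite -(dvdn_pmul2l (cardG_gt0 P)) Lagrange // cardP -cardN.
  exact: cardSg.
have cardH : #|H| = (#|P| * #|'N_H(P) : P| * #|H : 'N_H(P)|)%N.
  by rewrite Lagrange // Lagrange ?subsetIl.
have mod1 := conjugates_mod121 sHG sPH sylP.
have := dvH; rewrite dvdn_divisors // (_ : divisors 5 = [:: 1; 5]%N) // !inE.
case/orP=> /eqP ind_P; rewrite ind_P cardP in cardH.
  left; rewrite (self_normalising_Sylow11 sylP sPH sHG) ?normG //.
  by apply/esym/eqP; rewrite eqEcard sPN -(Lagrange sPN) ind_P muln1 /=.
have dv_n : #|H : 'N_H(P)| %| 2 ^ 9 * 3 ^ 10 * 13.
  rewrite -(dvdn_pmul2l (isT : 0 < 11 ^ 2 * 5)) -cardH -cardGN -cardN.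
  by rewrite Lagrange ?subsetIl // cardSg.
have dv_n5 : #|H : 'N_H(P)| %| 2 ^ 9 * 3 ^ 10 * 5 * 13.
  apply: dvdn_trans dv_n _; apply/dvdnP; exists 5%N; clear; lia.
have [ind1 | ind_neq1] := eqVneq #|H : 'N_H(P)| 1%N.
  left; have /eqP := ind1; rewrite indexg_eq1 => /subset_trans; apply.
  exact: subsetIr.
right; move: (#|H : 'N_H(P)|) ind_neq1 cardH mod1 dv_n dv_n5
  => n n_neq1 cardH mod1 dv_n dv_n5.
have [[i le_i def_n] | [i le_i def_n] | [m def_n _]] := divisors_1_mod_121 dv_n5 mod1.
- exists i => //; left; rewrite cardH def_n; split=> //.
  by move: n_neq1; rewrite def_n; case: (i).
- by exists i => //; right; rewrite cardH def_n.
have : 5 %| 2 ^ 9 * 3 ^ 10 * 13.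
  by apply: dvdn_trans dv_n; rewrite def_n -mulnA dvdn_mulr.
by clear; rewrite !(Euclid_dvdM _ _ (isT : prime 5)).
Qed.

Lemma neg_eq0 m n (A : 'M[F]_(m, n)) : (A = - A)%R -> A = 0%R.
Proof.
by move=> AN; apply/matrixP=> i j; move/matrixP/(_ i j): AN; rewrite !mxE;
  case: (F3_cases (A i j)) => ->.
Qed.

(** No nontrivial element of P fixes a nonzero column or maps it to its
    opposite, so P has a single orbit on the 121 pairs of opposite nonzero
    columns, that is, on the hyperplanes of the space of row vectors. *)
Lemma Sylow11_col_trans P phi psi :
    11.-Sylow(G) P -> phi != 0%R -> psi != 0%R ->
  exists2 p, p \in P & (mx p *m phi = psi \/ mx p *m phi = - psi)%R.
Proof.
move=> sylP nz_phi nz_psi; have pP := pHall_pgroup sylP.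
have fix1 p : p \in P -> (mx p *m phi = phi)%R -> p = 1.
  move=> Pp fix_phi; apply/eqP; apply: contraNT nz_phi => ntp.
  rewrite -(mulKmx (unit_sub1_11 (mem_p_elt pP Pp) ntp) phi).
  by rewrite mulmxBl mul1mx fix_phi subrr mulmx0.
have fixN p : p \in P -> (mx p *m phi <> - phi)%R.
  move=> Pp fix_phi; case/eqP: nz_phi; apply: neg_eq0.
  have p2 : p ^+ 2 = 1.
    by apply: fix1; rewrite ?groupX // mxM -mulmxA fix_phi mulmxN fix_phi opprK.
  have p1 : p = 1.
    apply/eqP; rewrite -order_eq1; apply/eqP/(pnat_1 (mem_p_elt pP Pp)).
    by apply: (@pnat_dvd _ 2) => //; rewrite order_dvdn p2.
  by rewrite -fix_phi p1 mx1 mul1mx.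
pose f (u : L * bool) : 'cV[F]_5 := ((-1) ^+ u.2 *: (mx u.1 *m phi))%R.
have inj_f : {in setX P [set: bool] &, injective f}.
  move=> [p b] [q c]; rewrite !inE !andbT /f /= => Pp Pq eq_f.
  have Pqp : q^-1 * p \in P by rewrite groupM ?groupV.
  have {eq_f} eq_f : (mx (q^-1 * p)%g *m phi = (-1) ^+ (b (+) c) *: phi)%R.
    rewrite mxM -mulmxA signr_addb -scalerA -[(mx p *m phi)%R](signrZK b) eq_f.
    by rewrite -!scalemxAr mulmxA -mxM mulVg mx1 mul1mx.
  case: (b =P c) eq_f => [<- | /eqP neq_bc].
    rewrite addbb expr0 scale1r => /(fix1 _ Pqp) qp1.
    by congr (_, _); rewrite -[p](mulKVg q) qp1 mulg1.
  rewrite -negb_eqb (negPf neq_bc) expr1 scaleN1r.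
  by move=> /fixN-/(_ Pqp).
have card_f : #|f @: setX P [set: bool]| = 242.
  by rewrite (card_in_imset inj_f) cardsX cardsT card_bool (card_Sylow11 sylP).
have : psi \in f @: setX P [set: bool].
  suffices -> : f @: setX P [set: bool] = [set~ 0%R] by rewrite !inE.
  apply/eqP; rewrite eqEcard card_f cardsC1 card_mx card_ord leqnn andbT.
  apply/subsetP=> _ /imsetP[[p b] _ ->]; rewrite !inE /f scaler_eq0 signr_eq0 /=.
  apply: contraNneq nz_phi => p_phi0.
  by rewrite -(mulKmx (mx_unit p) phi) p_phi0 mulmx0.
case/imsetP=> [[p b]]; rewrite !inE andbT /f /= => Pp ->; exists p => //.
by case: b; [right | left]; rewrite ?scale1r ?scaleN1r ?opprK.
Qed.

Lemma rank_kermx_col phi : phi != 0%R -> \rank (kermx phi) = 4.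
Proof.
move=> nz_phi; rewrite mxrank_ker; have := rank_leq_col phi.
by have := nz_phi; rewrite -mxrank_eq0; case: (\rank phi) => [|[]].
Qed.

Lemma stab_kermxP phi g :
  reflect (kermx phi *m (mx g *m phi) = 0)%R (g \in stab L (kermx phi)).
Proof.
rewrite inE; apply: (iffP idP) => [/sub_kermxP | ker0]; first by rewrite mulmxA.
by apply/sub_kermxP; rewrite -mulmxA.
Qed.

Lemma kermx_col_scale phi psi : phi != 0%R -> (kermx phi *m psi = 0)%R ->
  exists a : F, psi = (a *: phi)%R.
Proof.
move=> nz_phi ker0.
have full_phi : row_full phi.
  have := rank_leq_col phi; have := nz_phi; rewrite -mxrank_eq0 /row_full.
  by case: (\rank phi) => [|[]].
have [e e_phi] := row_fullP full_phi; exists ((e *m psi) 0 0)%R.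
have sub : ((1%:M - phi *m e)%R <= kermx phi)%MS.
  by apply/sub_kermxP; rewrite mulmxBl mul1mx -mulmxA e_phi mulmx1 subrr.
have /submxP[B defB] := sub; apply/eqP.
have /eqP : ((1%:M - phi *m e) *m psi = 0)%R by rewrite defB -mulmxA ker0 mulmx0.
rewrite mulmxBl mul1mx subr_eq0 -mulmxA => /eqP def_psi.
by rewrite {1}def_psi [X in (phi *m X)%R]mx11_scalar mul_mx_scalar.
Qed.

Lemma stab_kermx_col phi g : phi != 0%R -> g \in stab L (kermx phi) ->
  (mx g *m phi = phi \/ mx g *m phi = - phi)%R.
Proof.
move=> nz_phi /stab_kermxP/(kermx_col_scale nz_phi)[a def_gphi].
have : (mx g *m phi)%R != 0%R.
  by apply: contraNneq nz_phi => g0; rewrite -(mulKmx (mx_unit g) phi) g0 mulmx0.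
rewrite def_gphi; case: (F3_cases a) => ->; rewrite ?scale0r ?eqxx //.
  by rewrite scale1r; left.
by rewrite scaleN1r; right.
Qed.

(** P is regular on the hyperplanes, hence a complement in H to the stabiliser
    of any of them. *)
Lemma card_hyperplane_stab H P phi :
    11.-Sylow(G) P -> P \subset H -> phi != 0%R ->
  #|H| = (121 * #|H :&: stab L (kermx phi)|)%N.
Proof.
move=> sylP sPH nz_phi; set S := H :&: _; have pP := pHall_pgroup sylP.
have tiPS : P :&: S = 1.
  apply/eqP; apply: contraT => ntI.
  have [||] := irr11 (pgroupS (subsetIl P S) pP) ntI (W := kermx phi).
  - by rewrite !subIset ?subxx ?orbT.
  - by rewrite rank_kermx_col.
  - by rewrite rank_kermx_col.
rewrite -[121]/(11 ^ 2)%N -(card_Sylow11 sylP) -(TI_cardMg tiPS).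
apply: eq_card => h; apply/idP/mulsgP => [Hh | [p s Pp /setIP[Hs _] ->]]; last first.
  by rewrite groupM // (subsetP sPH).
have nz_hphi : (mx h *m phi)%R != 0%R.
  by apply: contraNneq nz_phi => h0; rewrite -(mulKmx (mx_unit h) phi) h0 mulmx0.
have [p Pp p_phi] := Sylow11_col_trans sylP nz_phi nz_hphi.
exists p (p^-1 * h) => //; last by rewrite mulKVg.
rewrite inE groupM ?groupV ?(subsetP sPH p) //=; apply/stab_kermxP.
have p_ker : (kermx phi *m (mx p^-1%g *m (mx p *m phi)) = 0)%R.
  by rewrite (mulmxA (mx p^-1)) -mxM mulVg mx1 mul1mx mulmx_ker.
rewrite mxM -mulmxA; case: p_phi => [<- // | p_phi].
by move: p_ker; rewrite p_phi !mulmxN => /eqP; rewrite oppr_eq0 => /eqP.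
Qed.

End Hyperplanes.

(** * Overgroups of a Sylow 11-subgroup: the odd case *)
Section OddOvergroups.

Local Notation F := 'F_3.
Variable L : linear_group F 5.
Local Notation G := (specg_group L).
Implicit Types (H K R P Q : {group L}) (g f : L) (phi psi : 'cV[F]_5).

(** An element of order 5 has a fixed space of rank 1 and 3 has order 4
    modulo 5, so it is irreducible on each hyperplane it stabilises. *)
Lemma order5_irr_hyperplane f phi m (B : 'M[F]_(m, 5)) :
    phi != 0%R -> #[f] = 5 -> f \in stab L (kermx phi) ->
    (B <= kermx phi)%MS -> f \in stab L B ->
  \rank B = 0 \/ \rank B = 4.
Proof.
move=> nz_phi of5 fA sBA fB; have rA := rank_kermx_col nz_phi.
have pf : 5.-group <[f]> by rewrite /pgroup -orderE of5.
have ntf : <[f]> != 1 by rewrite -cardG_gt1 -orderE of5.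
have fixA0 : \rank (kermx phi :&: fixmx <[f]>)%MS = 0.
  have := card_fix_mod pf (_ : <[f]> \subset stab L (kermx phi)).
  rewrite cycle_subG rA card_ord => /(_ fA) eq_mod.
  have := mxrankS (capmxSr (kermx phi) (fixmx <[f]>)); rewrite rank_fix5 // => le1.
  have := exp3_mod5 (isT : 4 <= 5) (leq_trans le1 (isT : 1 <= 5)) eq_mod.
  by move: le1; case: (\rank _) => [|[]].
have := card_fix_mod pf (_ : <[f]> \subset stab L B); rewrite cycle_subG => /(_ fB).
have -> : \rank (B :&: fixmx <[f]>)%MS = 0.
  by apply/eqP; rewrite -leqn0 -[X in _ <= X]fixA0 mxrankS // capmxS.
rewrite card_ord => eq_mod; have := mxrankS sBA; rewrite rA => le4.
have := exp3_mod5 (rank_le5 B) (isT : 0 <= 5) eq_mod.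
by move: le4; case: (\rank B) => [|[|[|[|[|]]]]] // _ _; [left | right].
Qed.

Lemma order5_hyperplane H P phi : 11.-Sylow(G) P -> P \subset H ->
    phi != 0%R -> 605 %| #|H| ->
  exists2 f, f \in H :&: stab L (kermx phi) & #[f] = 5.
Proof.
move=> sylP sPH nz_phi; rewrite (card_hyperplane_stab sylP sPH nz_phi).
rewrite -[605]/(121 * 5)%N dvdn_pmul2l // => /Cauchy[] // f Sf of5.
by exists f.
Qed.

(** The stabiliser S in H of a hyperplane A would have order 5 * 3^(5i). The
    number of its Sylow 3-subgroups divides 5 and is 1 modulo 3, so its Sylow
    3-subgroup R is normal. The vectors of A that R fixes form a nonzero
    subspace invariant under an element of order 5, so R fixes A pointwise. The
    image of a vector off A then determines an element of R, and there are only
    3^5 - 3^4 such vectors, fewer than the order of R. *)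
Lemma overgroup_not_odd H P i : 11.-Sylow(G) P -> P \subset H -> 0 < i ->
  #|H| = (605 * 3 ^ (5 * i))%N -> False.
Proof.
move=> sylP sPH i_gt0 cardH.
pose phi : 'cV[F]_5 := delta_mx 0%R 0%R.
have nz_phi : phi != 0%R by apply/eqP=> /colP/(_ 0%R)/eqP; rewrite !mxE !eqxx.
have rA := rank_kermx_col nz_phi; set A := kermx phi in rA.
have dv605 : 605 %| #|H| by rewrite cardH dvdn_mulr.
have [f Sf of5] := order5_hyperplane sylP sPH nz_phi dv605.
have := card_hyperplane_stab sylP sPH nz_phi; rewrite cardH; move: Sf.
set S := H :&: stab L (kermx phi) => Sf /eqP.
rewrite -[605]/(121 * 5)%N -mulnA eqn_pmul2l // => /eqP/esym cardS.
have [R sylR] := Sylow_exists 3 [group of S].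
have cardR : #|R| = (3 ^ (5 * i))%N.
  rewrite (card_Hall sylR) cardS partnM ?expn_gt0 // part_p'nat //.
  by rewrite mul1n part_pnat_id // pnatX.
have sRS : R \subset S := pHall_sub sylR.
have nRS : [group of S] \subset 'N(R).
  suffices /normal_sylowP[Q sylQ nQS] : #|'Syl_3([group of S])| == 1%N.
    have [x Sx ->] := Sylow_trans sylQ sylR.
    by rewrite (normsP (normal_norm nQS)) ?normal_norm.
  have := card_Syl_mod [group of S] (isT : prime 3).
  have : #|'Syl_3([group of S])| %| 5.
    rewrite (card_Syl sylR) -(dvdn_pmul2l (cardG_gt0 R)).
    have -> : (#|R| * 5 = #|S|)%N by rewrite cardS cardR mulnC.
    rewrite -(Lagrange sRS).
    rewrite dvdn_pmul2l ?cardG_gt0 // indexgS // subsetI sRS /=.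
    exact: normG.
  rewrite dvdn_divisors // (_ : divisors 5 = [:: 1; 5]%N) // !inE.
  by case/orP=> /eqP->.
have pR := pHall_pgroup sylR.
have sRA : R \subset stab L A.
  by apply: subset_trans sRS _; rewrite subsetIr.
have fixA : (A <= fixmx R)%MS.
  have [_ fA] := setIP Sf.
  have fB : f \in stab L (A :&: fixmx R)%MS.
    rewrite inE sub_capmx; rewrite inE in fA.
    rewrite (submx_trans (submxMr _ (capmxSl _ _)) fA) /=.
    apply: submx_trans (submxMr _ (capmxSr _ _)) _.
    by have := subsetP (fixmx_stab R) f (subsetP nRS f Sf); rewrite inE.
  have [|eq4] := order5_irr_hyperplane nz_phi of5 fA (capmxSl _ _) fB.
    by have := card_fix_mod pR sRA; rewrite rA card_ord => + r0; rewrite r0.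
  apply: submx_trans (capmxSr A _).
  have : (A :&: fixmx R == A)%MS.
    by rewrite -(geq_leqif (mxrank_leqif_eq (capmxSl A (fixmx R)))) eq4 rA.
  by case/andP.
pose e : 'rV[F]_5 := delta_mx 0%R 0%R.
have e_phi : (e *m phi)%R != 0%R.
  by rewrite mul_delta_mx; apply/eqP=> /matrixP/(_ 0 0)%R/eqP; rewrite !mxE !eqxx.
have sAe_full : row_full (A + e)%MS.
  have : \rank A < \rank (A + e)%MS.
    rewrite ltnNge; apply: contraNN e_phi => le_r.
    have : (A == A + e)%MS.
      by rewrite -(geq_leqif (mxrank_leqif_eq (addsmxSl A e))).
    by case/andP=> _ sA; apply/eqP/sub_kermxP; apply: submx_trans (addsmxSr A e) sA.
  by rewrite rA /row_full eqn_leq rank_le5 => ->.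
have inj_e : {in R &, injective (fun g => e *m mx g)%R}.
  move=> g h Rg Rh eq_e; apply/mx_inj/eqP; rewrite -subr_eq0; apply/eqP/kermx_full.
  rewrite -sub1mx; apply: submx_trans (_ : ((A + e)%MS <= _)%MS); first by rewrite sub1mx.
  rewrite addsmx_sub; apply/andP; split; apply/sub_kermxP; rewrite mulmxBr.
    by rewrite !(fixmxP _ _ fixA) // subrr.
  by rewrite eq_e subrr.
have : #|R| <= #|setT :\: rowg A|.
  rewrite -(card_in_imset inj_e); apply/subset_leq_card/subsetP=> _ /imsetP[g Rg ->].
  rewrite !inE andbT; apply: contraNN e_phi => /sub_kermxP eg0.
  case: (stab_kermx_col nz_phi (subsetP sRA g Rg)) eg0 => gphi.
    by rewrite -mulmxA gphi => ->.
  by rewrite -mulmxA gphi mulmxN => /eqP; rewrite oppr_eq0.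
rewrite cardsD setTI cardsT card_mx card_rowg rA card_ord cardR leqNgt.
case/negP; apply: (@leq_trans (3 ^ 5)) => //.
by rewrite leq_exp2l // -{1}[5]muln1 leq_mul2l.
Qed.

End OddOvergroups.

(** * Homologies and transvections *)
Section Polarity.

Local Open Scope ring_scope.
Local Notation F := 'F_3.
Implicit Types (phi psi : 'cV[F]_5) (c : 'rV[F]_5).

Lemma exists_col_killed k (M : 'M[F]_(k, 5)) : (k < 5)%N ->
  exists2 psi : 'cV[F]_5, psi != 0 & M *m psi = 0.
Proof.
move=> lt_k5; pose K := kermx M^T.
have nzK : K != 0.
  rewrite -mxrank_eq0 mxrank_ker mxrank_tr subn_eq0 -ltnNge.
  exact: leq_ltn_trans (rank_leq_row M) lt_k5.
have [i nzKi] : exists i, row i K != 0.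
  apply/existsP; apply: contraR nzK; rewrite negb_exists => /forallP rows0.
  by apply/eqP/row_matrixP=> i; rewrite row0; apply/eqP; rewrite -[_ == _]negbK.
exists (row i K)^T; first by rewrite trmx_eq0.
by apply: trmx_inj; rewrite trmx_mul trmxK trmx0 -row_mul mulmx_ker row0.
Qed.

Lemma F3_sum0 (a b : F) : a != 0 -> b != 0 -> a != b -> a + b = 0.
Proof.
by case: (F3_cases a) => ->; case: (F3_cases b) => ->; rewrite ?eqxx // => _ _ _;
  apply: val_inj.
Qed.

Lemma F3_triple (a : F) : a + a + a = 0.
Proof. by case: (F3_cases a) => ->; apply: val_inj. Qed.

(** If c_phi psi = 0 were a symmetric relation, take phi, psi, chi pairwise
    orthogonal and s their sum. Over F_3 the vectors psi + chi and psi - chi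
    are orthogonal, so s is orthogonal to psi - chi and to phi - psi; hence
    c_s takes the same value on phi, psi and chi, and c_s s = 0. *)
Lemma no_anisotropic_polarity (c : 'cV[F]_5 -> 'rV[F]_5) :
    (forall phi, phi != 0 -> c phi *m phi = 1%:M) ->
    (forall phi psi, phi != 0 -> psi != 0 ->
      c phi *m psi = 0 -> c psi *m phi = 0) ->
  False.
Proof.
move=> c1 csym; pose b phi psi : F := (c phi *m psi) 0 0.
have b0P phi psi : b phi psi = 0 <-> c phi *m psi = 0.
  split=> [b0 | e0]; last by rewrite /b e0 mxE.
  by rewrite [LHS]mx11_scalar -/(b phi psi) b0 raddf0.
have bD phi psi chi : b phi (psi + chi) = b phi psi + b phi chi.
  by rewrite /b mulmxDr mxE.
have bN phi psi : b phi (- psi) = - b phi psi by rewrite /b mulmxN mxE.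
have b11 phi : phi != 0 -> b phi phi = 1 by move=> nz; rewrite /b c1 // mxE.
have bsym phi psi : phi != 0 -> psi != 0 -> b phi psi = 0 -> b psi phi = 0.
  by move=> nz1 nz2 /b0P/(csym _ _ nz1 nz2)/b0P.
have sum_orth phi psi chi : phi != 0 -> psi != 0 -> chi != 0 ->
    b phi psi = 0 -> b phi chi = 0 -> b psi chi = 0 ->
    b (phi + psi + chi) (psi - chi) = 0.
  move=> nz1 nz2 nz3 b12 b13 b23.
  have b32 := bsym _ _ nz2 nz3 b23.
  have nzs : phi + psi + chi != 0.
    apply: contra_eq_neq (b11 _ nz1) => s0; have := bD phi (phi + psi) chi.
    by rewrite s0 bD b12 b13 !addr0 /b mulmx0 mxE => <-.
  have nzd : psi - chi != 0.
    apply: contra_eq_neq (b11 _ nz2) => d0; have := bD psi psi (- chi).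
    by rewrite d0 bN b23 oppr0 addr0 /b mulmx0 mxE => <-.
  apply: (bsym) => //; rewrite -addrA bD (bsym phi) ?add0r ?bD //; last first.
    by rewrite bN b12 b13 subrr.
  have := b11 _ nzd; set d := psi - chi => bd.
  have {}bd : b d psi - b d chi = 1 by rewrite -bN -bD.
  apply: F3_sum0.
  - apply/eqP=> /(bsym _ _ nzd nz2); rewrite bD bN b23 (b11 _ nz2) subr0.
    by move/eqP.
  - apply/eqP=> /(bsym _ _ nzd nz3); rewrite bD bN b32 (b11 _ nz3) add0r.
    by move/eqP.
  - by apply/eqP=> e; move: bd; rewrite e subrr => /eqP.
pose phi : 'cV[F]_5 := delta_mx 0 0.
have nz1 : phi != 0 by apply/eqP=> /colP/(_ 0)/eqP; rewrite !mxE !eqxx.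
have [psi nz2 b12] := exists_col_killed (c phi) isT.
have [chi nz3] := exists_col_killed (col_mx (c phi) (c psi)) isT.
rewrite mul_col_mx -col_mx0 => /eq_col_mx[/b0P b13 /b0P b23].
have {}b12 : b phi psi = 0 by apply/b0P.
have s23 := sum_orth _ _ _ nz1 nz2 nz3 b12 b13 b23.
have s12 : b (phi + psi + chi) (phi - psi) = 0.
  have := sum_orth _ _ _ nz3 nz1 nz2 (bsym _ _ nz1 nz3 b13) (bsym _ _ nz2 nz3 b23) b12.
  by rewrite -addrA addrC.
have nzs : phi + psi + chi != 0.
  apply: contra_eq_neq (b11 _ nz1) => s0; have := bD phi (phi + psi) chi.
  by rewrite s0 bD b12 b13 !addr0 /b mulmx0 mxE => <-.
have := b11 _ nzs; set s := phi + psi + chi in s23 s12 *.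
rewrite {2}/s !bD; move: s12 s23; rewrite !bD !bN => /eqP; rewrite subr_eq0 => /eqP->.
by move=> /eqP; rewrite subr_eq0 => /eqP->; rewrite F3_triple => /eqP.
Qed.

End Polarity.

Section Transvections.

Local Open Scope ring_scope.
Local Notation F := 'F_3.
Variable L : linear_group F 5.
Local Notation G := (specg_group L).
Implicit Types (H P : {group L}) (g t x : L) (phi psi : 'cV[F]_5) (c : 'rV[F]_5).

Lemma mx_conj_rank1 t x (a : F) phi c :
  mx t = a%:M + phi *m c ->
  mx (t ^ x)%g = a%:M + (mx x^-1%g *m phi) *m (c *m mx x).
Proof.
move=> def_t; rewrite conjgE !mxM def_t mulmxDl mulmxDr; congr (_ + _).
  by rewrite -scalar_mxC mulmxA -mxM mulVg mx1 mul1mx.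
by rewrite !mulmxA.
Qed.

(** The centers of the transvections in H with axis kermx phi, together with 0,
    which stands for the identity. The map c |-> 1 + phi c is a morphism on the
    rows killed by phi, so this is an additive group. *)
Definition transvections H phi : {set 'rV[F]_5} :=
  [set c | (c *m phi == 0) && [exists t in H, mx t == 1%:M + phi *m c]].

Lemma transvectionsP H phi c :
  reflect (c *m phi = 0 /\ exists2 t, t \in H & mx t = 1%:M + phi *m c)
          (c \in transvections H phi).
Proof.
rewrite inE; apply: (iffP andP) => [[/eqP-> /exists_inP[t Ht /eqP def_t]]|].
  by split=> //; exists t.
by case=> -> [t Ht /eqP def_t]; split=> //; apply/exists_inP; exists t.
Qed.

Fact transvections_group_set H phi : group_set (transvections H phi).
Proof.
apply/group_setP; split=> [|c d].
  apply/transvectionsP; split; first exact: mul0mx.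
  by exists 1%g; rewrite ?group1 // mx1 mulmx0 addr0.
case/transvectionsP=> c0 [t Ht def_t] /transvectionsP[d0 [u Hu def_u]].
apply/transvectionsP; split; first by rewrite mulmxDl c0 d0 addr0.
exists (t * u)%g; first exact: groupM.
rewrite mxM def_t def_u mulmxDl mul1mx mulmxDr mulmx1 mulmxA -(mulmxA phi) c0.
by rewrite mulmx0 mul0mx addr0 -addrA -mulmxDr [d + c]addrC.
Qed.
Canonical transvections_group H phi := Group (transvections_group_set H phi).

(** The centers of the transvections in H with a given axis form a subspace of
    the axis that is invariant under an element of order 5, hence 0 or the whole
    axis. *)
Lemma transvections_axis H P phi c :
    11.-Sylow(G)%g P -> P \subset H -> (605 %| #|H|)%N -> phi != 0 ->
    transvections H phi :!=: 1%g -> c *m phi = 0 ->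
  c \in transvections H phi.
Proof.
move=> sylP sPH dv605 nz_phi ntT c0.
set T := transvections_group H phi; pose M := rowg_mx T.
have defT : rowg M = T by apply: rowg_mxK.
have [f /setIP[Hf fA] of5] := order5_hyperplane sylP sPH nz_phi dv605.
have sMA : (M <= kermx phi)%MS.
  rewrite -rowgS defT; apply/subsetP=> d /transvectionsP[d0 _].
  by rewrite mem_rowg; apply/sub_kermxP.
have fM : f \in stab L M.
  rewrite inE; apply/row_subP=> i; rewrite row_mul -mem_rowg defT.
  have /transvectionsP[d0 [t Ht def_t]] : row i M \in T.
    by rewrite -defT mem_rowg row_sub.
  set d := row i M in d0 def_t *.
  have df0 : d *m mx f *m phi = 0.
    rewrite -mulmxA; case: (stab_kermx_col nz_phi fA) => ->; rewrite ?mulmxN d0 //.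
    exact: oppr0.
  have Htf : (t ^ f)%g \in H by rewrite groupJ.
  have := mx_conj_rank1 f def_t.
  have [|->|->] := stab_kermx_col nz_phi (_ : f^-1%g \in stab L (kermx phi)).
  - by rewrite groupV.
  - by move=> def_tf; apply/transvectionsP; split=> //; exists (t ^ f)%g.
  rewrite mulNmx -mulmxN => def_tf; rewrite -groupV; apply/transvectionsP; split.
    by rewrite mulNmx df0 oppr0.
  by exists (t ^ f)%g.
have [/eqP|r4] := order5_irr_hyperplane nz_phi of5 fA sMA fM.
  by rewrite mxrank_eq0 rowg_mx_eq0 (negPf ntT).
have : (M == kermx phi)%MS.
  by rewrite -(geq_leqif (mxrank_leqif_eq sMA)) r4 rank_kermx_col.
case/andP=> _ sAM; rewrite -[transvections _ _]/(gval T) -defT mem_rowg.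
by apply: submx_trans sAM; apply/sub_kermxP.
Qed.

(** P permutes the axes transitively. *)
Lemma transvections_conj H P phi psi :
    11.-Sylow(G)%g P -> P \subset H -> phi != 0 -> psi != 0 ->
  transvections H phi :!=: 1%g -> transvections H psi :!=: 1%g.
Proof.
move=> sylP sPH nz_phi nz_psi /trivgPn[c /transvectionsP[c0 [t Ht def_t]] ntc].
have [p Pp def_p] := Sylow11_col_trans sylP nz_phi nz_psi.
have Hp := subsetP sPH p Pp.
have := mx_conj_rank1 p^-1 def_t; rewrite invgK.
have Htp : (t ^ p^-1)%g \in H by rewrite groupJ ?groupV.
have nt_cp : c *m mx p^-1 != 0.
  by rewrite -(mul0mx _ (mx p^-1)) (inj_eq (row_free_inj (mx_free _))).
have cp0 : c *m mx p^-1 *m (mx p *m phi) = 0.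
  by rewrite -mulmxA (mulmxA (mx p^-1)) -mxM mulVg mx1 mul1mx.
case: def_p cp0 => -> cp0 def_tp; apply/trivgPn.
  exists (c *m mx p^-1) => //; apply/transvectionsP; split=> //.
  by exists (t ^ p^-1)%g; first exact: Htp.
exists (- (c *m mx p^-1)); last by rewrite oppr_eq0.
apply/transvectionsP; split; first by rewrite mulNmx -mulmxN.
by exists (t ^ p^-1)%g; [exact: Htp | rewrite def_tp mulmxN -mulNmx].
Qed.

(** The transvections whose axis contains, and whose center lies in, a fixed
    subspace of rank 2 generate a group isomorphic to the additive group of
    3 x 2 matrices. *)
Lemma transvections_card H :
    (forall phi c, c *m phi = 0 -> exists2 t, t \in H & mx t = 1%:M + phi *m c) ->
  (3 ^ 6 %| #|H|)%N.
Proof.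
move=> allH; pose A : 'M[F]_(2 + 3, 3) := col_mx 0 1%:M.
pose B : 'M[F]_(2, 2 + 3) := row_mx 1%:M 0.
have BA : B *m A = 0 by rewrite mul_row_col mul1mx mul0mx addr0.
pose U := [set t in H | [exists Y : 'M[F]_(3, 2), mx t == 1%:M + A *m Y *m B]].
have UP t : reflect (t \in H /\ exists Y, mx t = 1%:M + A *m Y *m B) (t \in U).
  rewrite inE; apply: (iffP andP) => [[-> /existsP[Y /eqP def_t]]|[-> [Y def_t]]].
    by split=> //; exists Y.
  by split=> //; apply/existsP; exists Y; rewrite def_t.
have mulU Y Z : (1%:M + A *m Y *m B) *m (1%:M + A *m Z *m B)
    = 1%:M + A *m (Y + Z) *m B.
  rewrite mulmxDl mul1mx mulmxDr mulmx1 -(mulmxA _ B) !(mulmxA B) BA !mul0mx.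
  by rewrite mulmx0 addr0 mulmxDr mulmxDl -addrA [A *m Z *m B + _]addrC.
have groupU : group_set U.
  apply/group_setP; split=> [|t u /UP[Ht [Y def_t]] /UP[Hu [Z def_u]]].
    by apply/UP; split=> //; exists 0; rewrite mulmx0 mul0mx addr0 mx1.
  by apply/UP; split; [exact: groupM | exists (Y + Z); rewrite mxM def_t def_u].
have onto Y : exists2 t, t \in H & mx t = 1%:M + A *m Y *m B.
  have -> : Y = \sum_i (Y *m delta_mx i 0) *m (delta_mx 0 i : 'rV_2).
    rewrite -[LHS]mulmx1 mx1_sum_delta mulmx_sumr; apply: eq_bigr => i _.
    by rewrite -mulmxA mul_delta_mx.
  elim/big_ind: _ => [|Y1 Y2 [t Ht def_t] [u Hu def_u]|i _].
  - by exists 1%g; rewrite // mulmx0 mul0mx addr0 mx1.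
  - by exists (t * u)%g; [exact: groupM | rewrite mxM def_t def_u mulU].
  rewrite mulmxA -mulmxA; apply: allH.
  by rewrite -mulmxA (mulmxA B) BA mul0mx mulmx0.
have injU (Y Z : 'M[F]_(3, 2)) : A *m Y *m B = A *m Z *m B -> Y = Z.
  have A'A : row_mx 0 1%:M *m A = 1%:M :> 'M[F]_3.
    by rewrite mul_row_col mul0mx mul1mx add0r.
  have BB' : B *m col_mx 1%:M 0 = 1%:M by rewrite mul_row_col mul1mx mul0mx addr0.
  move/(congr1 (fun X => row_mx 0 1%:M *m X *m col_mx 1%:M 0)).
  by rewrite !mulmxA A'A !mul1mx -!mulmxA BB' !mulmx1.
have cardU : #|U| = (3 ^ 6)%N.
  have [h /all_and2[Hh def_h]] := fin_all_exists (fun Y =>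
    let: ex_intro2 t Ht def_t := onto Y in
    ex_intro (fun t => t \in H /\ mx t = _) t (conj Ht def_t)).
  have inj_h : injective h.
    move=> Y Z /(congr1 (@mx _ _ L)); rewrite !def_h => /addrI; exact: injU.
  rewrite (_ : U = h @: setT); first by rewrite card_imset // cardsT card_mx card_ord.
  apply/setP=> t; apply/idP/imsetP=> [/UP[Ht [Y def_t]] | [Y _ ->]].
    by exists Y; rewrite ?inE //; apply: mx_inj; rewrite def_t def_h.
  by apply/UP; split=> //; exists Y.
rewrite -cardU; apply: (@cardSg _ H (Group groupU)).
by apply/subsetP=> t /UP[].
Qed.

(** The element - (1 + phi c) is the involution of determinant 1 that fixes c
    and is -1 on kermx phi. *)
Definition homology H phi c :=
  c *m phi = 1%:M /\ exists2 t, t \in H & mx t = - (1%:M + phi *m c).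

(** P permutes the hyperplanes transitively. *)
Lemma homology_conj H P phi psi c :
    11.-Sylow(G)%g P -> P \subset H -> phi != 0 -> psi != 0 ->
  homology H phi c -> exists d, homology H psi d.
Proof.
move=> sylP sPH nz_phi nz_psi [c1 [t Ht def_t]].
have [p Pp def_p] := Sylow11_col_trans sylP nz_phi nz_psi.
have Hp := subsetP sPH p Pp.
have : mx t = (-1)%:M + phi *m (- c) by rewrite def_t opprD raddfN mulmxN.
move/(mx_conj_rank1 p^-1); rewrite invgK mulNmx mulmxN raddfN -opprD => def_tp.
have cp1 : c *m mx p^-1 *m (mx p *m phi) = 1%:M.
  by rewrite -mulmxA (mulmxA (mx p^-1)) -mxM mulVg mx1 mul1mx.
have Htp : (t ^ p^-1)%g \in H by rewrite groupJ ?groupV.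
case: def_p cp1 def_tp => -> cp1 def_tp.
  by exists (c *m mx p^-1); split=> //; exists (t ^ p^-1)%g.
exists (- (c *m mx p^-1)); split; first by rewrite mulNmx -mulmxN.
by exists (t ^ p^-1)%g; [exact: Htp | rewrite def_tp mulmxN -mulNmx].
Qed.

(** The square of the product of the two homologies is a transvection: with
    N = phi c + psi d and a = d phi, the product is 1 + N and N^2 = N + a psi c,
    so that (1 + N)^2 = 1 + 3 N + a psi c = 1 + a psi c. *)
Lemma homology_transvection H phi psi c d :
    homology H phi c -> homology H psi d ->
  c *m psi = 0 -> d *m phi != 0 -> transvections H psi :!=: 1%g.
Proof.
move=> [c1 [t Ht def_t]] [d1 [u Hu def_u]] c0 nz_d.
pose a : F := (d *m phi) 0 0.
have da : d *m phi = a%:M by rewrite [LHS]mx11_scalar.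
have nz_a : a != 0 by apply: contraNneq nz_d => a0; rewrite da a0 raddf0.
have nz_c : c != 0.
  by apply/eqP=> cz; move: c1; rewrite cz mul0mx => /matrixP/(_ 0 0)/eqP; rewrite !mxE.
apply/trivgPn; exists (a *: c); last by rewrite scaler_eq0 negb_or nz_a.
apply/transvectionsP; split; first by rewrite -scalemxAl c0 scaler0.
exists ((t * u) * (t * u))%g; first by rewrite !groupM.
have def_tu : mx (t * u)%g = 1%:M + (phi *m c + psi *m d).
  rewrite mxM def_t def_u mulNmx mulmxN opprK mulmxDl mul1mx mulmxDr mulmx1.
  rewrite mulmxA -(mulmxA phi) c0 mulmx0 mul0mx addr0 -addrA.
  by rewrite [psi *m d + _]addrC.
set N := phi *m c + psi *m d in def_tu.
have N2 : N *m N = N + psi *m (a *: c).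
  rewrite mulmxDl !mulmxDr !mulmxA -!(mulmxA _ c) -!(mulmxA _ d) c1 c0 d1 da.
  rewrite !mulmx1 mulmx0 mul0mx addr0 mul_mx_scalar -scalemxAl -scalemxAr.
  by rewrite [a *: _ + _]addrC addrA.
have N3 : N + N + N = 0 by apply/matrixP=> i j; rewrite !mxE; apply: F3_triple.
clearbody N; rewrite mxM def_tu mulmxDl mul1mx mulmxDr mulmx1 N2 -addrA; congr (_ + _).
by rewrite !addrA N3 add0r.
Qed.

(** H contains a Sylow 2-subgroup of G, hence a conjugate of the involution
    diag(1, -1, -1, -1, -1). *)
Lemma homology_exists H : H \subset G -> (#|H|`_2 = 2 ^ 9)%N ->
  exists phi, phi != 0 /\ exists c, homology H phi c.
Proof.
move=> sHG oH2; pose phi : 'cV[F]_5 := delta_mx 0 0.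
pose c : 'rV[F]_5 := delta_mx 0 0.
have c1 : c *m phi = 1%:M.
  by rewrite mul_delta_mx; apply/matrixP=> i j; rewrite !mxE !ord1.
pose d : 'rV[F]_5 := \row_j (if j == 0 then 1 else -1).
have def_d : diag_mx d = - (1%:M + phi *m c).
  rewrite mul_delta_mx; apply/matrixP=> i j; rewrite !mxE.
  case: (i =P j) => [<-|/eqP neq_ij]; last first.
    rewrite mulr0n; case: (i =P 0) => [i0|_]; case: (j =P 0) => [j0|_] //=.
    - by rewrite i0 j0 eqxx in neq_ij.
    - by rewrite addr0 oppr0.
    - by rewrite addr0 oppr0.
    by rewrite addr0 oppr0.
  by rewrite mulr1n andbb; case: (i == 0); apply: val_inj.
have det_d : \det (diag_mx d) = 1.
  by rewrite det_diag !big_ord_recl big_ord0 !mxE; apply: val_inj.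
have [|t def_t] := @mx_onto _ _ L (diag_mx d).
  by rewrite unitmxE det_d unitr1.
have Gt : t \in G by rewrite inE def_t det_d.
have t2 : (t ^+ 2 = 1)%g.
  apply: mx_inj; rewrite mxM def_t mulmx_diag mx1 -diag_const_mx; congr diag_mx.
  by apply/rowP=> j; rewrite !mxE; case: (j == 0); apply: val_inj.
have pt : 2.-group <[t]>%g.
  by rewrite /pgroup -orderE (@pnat_dvd _ 2) // order_dvdn t2.
have sTG : <[t]>%g \subset G by rewrite cycle_subG.
have [S sylS sTS] := Sylow_superset sTG pt.
have [Q sylQ] := Sylow_exists 2 H.
have oG2 : (#|G|`_2 = 2 ^ 9)%N.
  rewrite card_SL53.
  have -> : (11 ^ 2 * (2 ^ 9 * 3 ^ 10 * 5 * 13) = 2 ^ 9 * (11 ^ 2 * 3 ^ 10 * 5 * 13))%N.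
    by clear; lia.
  clear; apply: prime_part_mul; first by [].
  by rewrite !Euclid_dvdM ?Euclid_dvdX.
have sylQG : (2.-Sylow(G) Q)%g.
  rewrite pHallE (subset_trans (pHall_sub sylQ) sHG) (card_Hall sylQ) oH2 oG2.
  exact: eqxx.
have [x Gx defQ] := Sylow_trans sylS sylQG.
have Htx : (t ^ x)%g \in H.
  apply: (subsetP (pHall_sub sylQ)); rewrite defQ memJ_conjg.
  by apply: (subsetP sTS); apply: cycle_id.
have {}def_t : mx t = (-1)%:M + phi *m (- c) by rewrite def_t def_d opprD raddfN mulmxN.
exists (mx x^-1 *m phi); split.
  apply: contraTneq isT => x_phi0; have := congr1 (mulmx (mx x)) x_phi0.
  rewrite mulmxA -mxM mulgV mx1 mul1mx mulmx0 => phi0.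
  by move: c1; rewrite phi0 mulmx0 => /matrixP/(_ 0 0)/eqP; rewrite !mxE.
exists (c *m mx x); split.
  by rewrite -mulmxA (mulmxA (mx x)) -mxM mulgV mx1 mul1mx.
exists (t ^ x)%g; first exact: Htx.
by rewrite (mx_conj_rank1 x def_t) mulNmx mulmxN raddfN -opprD.
Qed.

(** As P is transitive on hyperplanes, H contains a homology for each of them.
    If the choice of their centers is not a polarity, two of them produce a
    transvection; then H contains all transvections, so 3^6 divides its order,
    which is only possible for i = 2, that is, when H has the order of G. *)
Lemma overgroup_even H P i :
    11.-Sylow(G)%g P -> P \subset H -> H \subset G -> (i <= 2)%N ->
    #|H| = (605 * (2 ^ 9 * 13 * 3 ^ (5 * i)))%N ->
  H :=: G.
Proof.
move=> sylP sPH sHG le_i2 cardH.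
have dv605 : (605 %| #|H|)%N by rewrite cardH dvdn_mulr.
have oH2 : (#|H|`_2 = 2 ^ 9)%N.
  rewrite cardH; clear; rewrite (_ : _ * _ = 2 ^ 9 * (605 * 13 * 3 ^ (5 * i)))%N.
    apply: prime_part_mul; first by [].
    rewrite !(Euclid_dvdM _ _ (isT : prime 2)) (Euclid_dvdX _ _ (isT : prime 2)).
    by [].
  by lia.
have [phi0 [nz_phi0 [c0 hom0]]] := homology_exists sHG oH2.
have hom phi : exists c, phi != 0 -> homology H phi c.
  have [-> | nz_phi] := eqVneq phi 0; first by exists 0.
  by have [c homc] := homology_conj sylP sPH nz_phi0 nz_phi hom0; exists c.
have {hom} [c hom] := fin_all_exists hom.
have [psi nz_psi ntT] : exists2 psi, psi != 0 & transvections H psi :!=: 1%g.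
  apply/exists_inP; apply: contraT; rewrite negb_exists_in => /forall_inP triv.
  case: (no_anisotropic_polarity (c := c)) => [phi /hom[]//|phi psi nz_phi nz_psi c0'].
  have homs := homology_transvection (hom phi nz_phi) (hom psi nz_psi) c0'.
  by apply: contraNeq (triv psi nz_psi).
have all phi d : d *m phi = 0 -> exists2 t, t \in H & mx t = 1%:M + phi *m d.
  have [-> _ | nz_phi] := eqVneq phi 0.
    by exists 1%g; rewrite ?group1 // mx1 mul0mx addr0.
  have ntT' := transvections_conj sylP sPH nz_psi nz_phi ntT.
  by case/(transvections_axis sylP sPH dv605 nz_phi ntT')/transvectionsP.
have dv36 := transvections_card all.
have i2 : i = 2.
  move: dv36; rewrite cardH; clear -le_i2.
  case: i le_i2 => [|[|[|i]]] le_i2.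
  - by case/dvdnP=> q; rewrite muln0 expn0; lia.
  - by case/dvdnP=> q; rewrite muln1; lia.
  - by [].
  by [].
apply/eqP; rewrite eqEcard sHG cardH card_SL53 i2; clear; lia.
Qed.

(** The order of an H that does not normalise P is one of those listed by
    card_over_Sylow11; the odd ones do not occur, and the even ones force
    H = G. *)
Lemma over_Sylow11 H P :
    11.-Sylow(G)%g P -> P \subset H -> H \subset G ->
  H \subset 'N(P)%g \/ H :=: G.
Proof.
move=> sylP sPH sHG.
have [|[i le_i [[i_gt0 cardH]|cardH]]] := card_over_Sylow11 sylP sPH sHG.
- by left.
- by case: (overgroup_not_odd sylP sPH i_gt0 cardH).
right; exact: overgroup_even sylP sPH sHG le_i cardH.
Qed.

End Transvections.

(** * Singer cycles *)
Section Singer.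

Local Open Scope ring_scope.
Local Notation F := 'F_3.

(** Multiplication by a generator of the multiplicative group of the field
    with 3 ^ k.+1 elements, in a basis over F_3: it is transitive on nonzero
    vectors and its power of order 2 is -1. *)
Lemma singer_exists k : exists s : 'M[F]_k.+1,
  (forall u v : 'rV_k.+1, u != 0 -> v != 0 -> exists i, u *m s ^+ i = v)
  /\ s ^+ (3 ^ k.+1).-1./2 = - 1.
Proof.
have [E char3 cardE] := pPrimePowerField (isT : prime 3) (ltn0Sn k).
have := pprimeChar_vectAxiom char3; rewrite cardE pfactorK //.
case=> f lin_f [g fK gK].
have /cyclicP[y defU] := field_unit_group_cyclic [group of [set: {unit E}]].
pose h (r : 'rV[F]_k.+1) : 'rV[F]_k.+1 := f (g r * val y).
have lin_g : linear g.
  by move=> a r1 r2; rewrite -[r1 in LHS]gK -[r2 in LHS]gK -lin_f fK.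
have lin_h : linear h.
  by move=> a r1 r2; rewrite /h lin_g mulrDl -scalerAl lin_f.
pose hL := GRing.isLinear.Build _ _ _ _ h lin_h.
pose hl : {linear 'rV[F]_k.+1 -> 'rV[F]_k.+1} := HB.pack h hL.
pose s := lin1_mx hl.
have sE r i : r *m s ^+ i = f (g r * val y ^+ i).
  elim: i => [|i IHi]; first by rewrite !expr0 mulmx1 mulr1 gK.
  by rewrite exprSr mulmxA IHi mul_rV_lin1 /= /h fK -mulrA -exprSr.
have g0 : g 0 = 0 by have := lin_g (-1) 0 0; rewrite scaler0 addr0 scaleN1r addNr.
have g_neq0 r : r != 0 -> g r != 0.
  by apply: contraNneq => gr0; rewrite -[r]gK gr0 -g0 gK.
exists s; split=> [u v nzu nzv|].
  have uq : g v / g u \is a GRing.unit.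
    by rewrite unitfE mulf_neq0 ?invr_eq0 ?g_neq0.
  have : FinRing.Unit uq \in <[y]>%g by rewrite -defU inE.
  case/cycleP=> i /(congr1 val) def_q; exists i.
  rewrite sE -[RHS]gK; congr f.
  have -> : val y ^+ i = g v / g u by rewrite -FinRing.val_unitX; apply/esym.
  by rewrite mulrCA divff ?mulr1 ?g_neq0.
set m := _./2.
have oy : #[y]%g = (3 ^ k.+1).-1.
  by rewrite orderE -defU card_finField_unit cardE.
have def_2m : (m * 2 = (3 ^ k.+1).-1)%N.
  have odd_q : odd (3 ^ k.+1) by rewrite oddX orbT.
  rewrite muln2 /m -[RHS]odd_double_half (_ : odd _.-1 = false) //.
  by rewrite -subn1 oddB ?expn_gt0 // odd_q.
have ym : val y ^+ m = -1.
  have /eqP : (val y ^+ m) ^+ 2 = 1.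
    by rewrite -exprM def_2m -oy -FinRing.val_unitX expg_order.
  rewrite sqrf_eq1 => /orP[/eqP y1 | /eqP //].
  have : (#[y] %| m)%N.
    by rewrite order_dvdn; apply/eqP/val_inj; rewrite /= FinRing.val_unitX y1.
  have m_gt0 : (0 < m)%N.
    rewrite -(ltn_pmul2r (isT : 0 < 2)%N) def_2m mul0n -subn1 subn_gt0.
    by rewrite (ltn_exp2l 0 _ (isT : 1 < 3)%N).
  move/(dvdn_leq m_gt0); rewrite oy -def_2m; lia.
apply/row_matrixP=> i; rewrite rowE [RHS]rowE sE ym mulrN1.
have f0 : f 0 = 0 by rewrite -g0 gK.
have fN x : f (- x) = - f x.
  by have := lin_f (-1) x 0; rewrite !scaleN1r addr0 f0 addr0.
by rewrite fN gK mulmxN mulmx1.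
Qed.

End Singer.

(** * Groups that are transitive on each of two blocks *)
Section TwoBlocks.

Local Open Scope ring_scope.
Local Notation F := 'F_3.
Variables (k l : nat) (L : linear_group F (k + l)).
Implicit Types (D H : {group L}).

Definition left_block : 'M[F]_(k, k + l) := row_mx 1%:M 0.
Definition right_block : 'M[F]_(l, k + l) := row_mx 0 1%:M.
Local Notation U := left_block.
Local Notation W := right_block.

(** The orbits of D on vectors are the four sets cut out by the vanishing of
    each of the two blocks. *)
Definition two_block D := forall (u u' : 'rV[F]_k) (w w' : 'rV[F]_l),
  (u == 0) = (u' == 0) -> (w == 0) = (w' == 0) ->
  exists2 d, d \in D & row_mx u w *m mx d = row_mx u' w'.

Lemma sub_left_block (u : 'rV[F]_k) (w : 'rV[F]_l) :
  (row_mx u w <= U)%MS = (w == 0).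
Proof.
apply/submxP/eqP=> [[a] | ->].
  by rewrite mul_mx_row mulmx0 => /eq_row_mx[].
by exists u; rewrite mul_mx_row mulmx0 mulmx1.
Qed.

Lemma sub_right_block (u : 'rV[F]_k) (w : 'rV[F]_l) :
  (row_mx u w <= W)%MS = (u == 0).
Proof.
apply/submxP/eqP=> [[a] | ->].
  by rewrite mul_mx_row mulmx0 => /eq_row_mx[].
by exists w; rewrite mul_mx_row mulmx0 mulmx1.
Qed.

Lemma rank_left_block : \rank U = k.
Proof.
apply/eqP; rewrite -[_ == _]/(row_free U); apply/row_freeP.
by exists (col_mx 1%:M 0); rewrite mul_row_col mulmx1 mul0mx addr0.
Qed.

Lemma rank_right_block : \rank W = l.
Proof.
apply/eqP; rewrite -[_ == _]/(row_free W); apply/row_freeP.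
by exists (col_mx 0 1%:M); rewrite mul_row_col mulmx1 mul0mx add0r.
Qed.

Lemma delta_neq0 n (i : 'I_n) : (delta_mx 0 i : 'rV[F]_n) != 0.
Proof. by apply/eqP=> /rowP/(_ i)/eqP; rewrite !mxE !eqxx. Qed.

(** If Y contains a vector with two nonzero components, it contains all of them,
    and their differences are all vectors; if not, Y is determined by the blocks
    that it meets. *)
Lemma two_block_subspace D m (Y : 'M[F]_(m, k + l)) :
    two_block D -> D \subset stab L Y ->
  [\/ \rank Y = 0, (Y :=: U)%MS, (Y :=: W)%MS | \rank Y = (k + l)%N].
Proof.
move=> trD sDY.
have Yact (u u' : 'rV_k) (w w' : 'rV_l) : (u == 0) = (u' == 0) ->
    (w == 0) = (w' == 0) -> (row_mx u w <= Y)%MS -> (row_mx u' w' <= Y)%MS.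
  move=> eu ew uwY; have [d Dd <-] := trD u u' w w' eu ew.
  have := subsetP sDY d Dd; rewrite inE => dY.
  exact: submx_trans (submxMr _ uwY) dY.
have subY p (X : 'M[F]_(p, k + l)) : (forall (u : 'rV_k) (w : 'rV_l),
    (row_mx u w <= Y)%MS -> (row_mx u w <= X)%MS) -> (Y <= X)%MS.
  move=> YX; apply/row_subP=> i; have := row_sub i Y.
  by rewrite -[row i Y]hsubmxK; apply: YX.
have [/existsP[u /existsP[w /and3P[nzu nzw uwY]]] | no_mixed] :=
    boolP [exists u : 'rV_k, exists w : 'rV_l,
      [&& u != 0, w != 0 & (row_mx u w <= Y)%MS]].
  constructor 4.
  have uY (u' : 'rV_k) : (row_mx u' (0 : 'rV_l) <= Y)%MS.
    have [->|nzu'] := eqVneq u' 0; first by rewrite row_mx0 sub0mx.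
    (* In characteristic 3, u' = - u' - u'. *)
    have -> : row_mx u' 0 = - row_mx u' w - row_mx u' (- w).
      rewrite !opp_row_mx opprK add_row_mx addNr; congr row_mx.
      by apply/rowP=> i; rewrite !mxE; case: (F3_cases (u' 0 i)) => ->; apply: val_inj.
    rewrite addmx_sub ?eqmx_opp //; apply: Yact uwY;
      by rewrite ?oppr_eq0 ?(negPf nzu) ?(negPf nzu') ?(negPf nzw).
  have wY (w' : 'rV_l) : (row_mx (0 : 'rV_k) w' <= Y)%MS.
    have [->|nzw'] := eqVneq w' 0; first by rewrite row_mx0 sub0mx.
    have -> : row_mx 0 w' = row_mx u w' - row_mx u 0.
      by rewrite opp_row_mx add_row_mx subrr oppr0 addr0.
    rewrite addmx_sub ?eqmx_opp ?uY //; apply: Yact uwY => //.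
    by rewrite (negPf nzw) (negPf nzw').
  apply/eqP; rewrite -[_ == _]/(row_full Y) -sub1mx.
  apply/row_subP=> i; rewrite -[row i _]hsubmxK.
  set v := lsubmx _; set z := rsubmx _.
  have -> : row_mx v z = row_mx v 0 + row_mx 0 z.
    by rewrite add_row_mx addr0 add0r.
  exact: addmx_sub.
have mixed (u : 'rV_k) (w : 'rV_l) : (row_mx u w <= Y)%MS -> u = 0 \/ w = 0.
  move=> uwY; have [|nzu] := eqVneq u 0; first by left.
  have [|nzw] := eqVneq w 0; first by right.
  case/negP: no_mixed; apply/existsP; exists u; apply/existsP; exists w.
  by rewrite nzu nzw.
have [/existsP[u /andP[nzu uY]] | no_left] :=
    boolP [exists u : 'rV_k, (u != 0) && (row_mx u (0 : 'rV_l) <= Y)%MS].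
  constructor 2; apply/eqmxP/andP; split.
    apply: subY => u' w' u'wY; rewrite sub_left_block.
    case: (mixed _ _ u'wY) => [u0 | ->]; last exact: eqxx.
    apply: contraT => nzw'; rewrite u0 in u'wY.
    have := addmx_sub uY u'wY; rewrite add_row_mx addr0 add0r => /mixed[] e.
      by rewrite e eqxx in nzu.
    by rewrite e eqxx in nzw'.
  apply/row_subP=> i; rewrite row_row_mx row0 row1.
  by apply: Yact uY; rewrite ?(negPf nzu) ?(negPf (delta_neq0 _)).
have left0 (u : 'rV_k) (w : 'rV_l) : (row_mx u w <= Y)%MS -> u = 0.
  move=> uwY; case: (mixed _ _ uwY) => [// | w0]; rewrite w0 in uwY.
  apply/eqP; apply: contraNT no_left => nzu.
  by apply/existsP; exists u; rewrite nzu.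
have [/existsP[w /andP[nzw wY]] | no_right] :=
    boolP [exists w : 'rV_l, (w != 0) && (row_mx (0 : 'rV_k) w <= Y)%MS].
  constructor 3; apply/eqmxP/andP; split.
    by apply: subY => u' w' /left0 ->; rewrite sub_right_block.
  apply/row_subP=> i; rewrite row_row_mx row0 row1.
  by apply: Yact wY; rewrite ?(negPf nzw) ?(negPf (delta_neq0 _)).
constructor 1; apply/eqP; rewrite mxrank_eq0 -submx0; apply: subY => u w uwY.
have u0 := left0 _ _ uwY; rewrite u0 in uwY *; apply: contraNT no_right => nzuw.
apply/existsP; exists w; rewrite uwY andbT; apply: contraNneq nzuw => ->.
by rewrite row_mx0 sub0mx.
Qed.

(** The H-orbit of a nonzero vector of one block is a union of D-orbits of
    nonzero vectors. Since H fixes neither block, it contains the nonzero vectors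
    of both. It has more elements than these, as their number does not divide the
    order of H; hence it contains all nonzero vectors. *)
Lemma two_block_transitive D H :
    two_block D -> (0 < k)%N -> (0 < l)%N -> D \subset H ->
    ~~ (H \subset stab L U) -> ~~ (H \subset stab L W) ->
    ~~ (3 ^ k + 3 ^ l - 2 %| #|H|)%N ->
  (3 ^ (k + l) - 1 %| #|H|)%N.
Proof.
move=> trD k_gt0 l_gt0 sDH nHU nHW ndvd.
pose u0 : 'rV[F]_k := delta_mx 0 (Ordinal k_gt0).
pose w0 : 'rV[F]_l := delta_mx 0 (Ordinal l_gt0).
have nzu0 : u0 != 0 := delta_neq0 _.
have nzw0 : w0 != 0 := delta_neq0 _.
pose O v := orbit (row_action L) H v.
have Oact v (u u' : 'rV_k) (w w' : 'rV_l) : (u == 0) = (u' == 0) ->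
    (w == 0) = (w' == 0) -> row_mx u w \in O v -> row_mx u' w' \in O v.
  move=> eu ew Ouw; have [d Dd <-] := trD u u' w w' eu ew.
  by rewrite -[_ *m _]/(row_action L _ d) orbit_actr //; apply: (subsetP sDH).
have [u1 [w1 [nzw1 Ou1]]] : exists u w, w != 0 /\ row_mx u w \in O (row_mx u0 0).
  have /subsetPn[h Hh] := nHU; rewrite inE => /row_subPn[i]; rewrite row_mul row_row_mx.
  rewrite row0 row1 => nUh; set v := row_mx _ _ *m _ in nUh.
  exists (lsubmx v), (rsubmx v); rewrite hsubmxK; split.
    by rewrite -(sub_left_block (lsubmx v)) hsubmxK.
  rewrite -[v]/(row_action L _ h) orbit_actr; last exact: Hh.
  by apply: Oact (orbit_refl _ _ _); rewrite ?(negPf nzu0) ?(negPf (delta_neq0 _)).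
have [u2 [w2 [nzu2 Ow2]]] : exists u w, u != 0 /\ row_mx u w \in O (row_mx 0 w0).
  have /subsetPn[h Hh] := nHW; rewrite inE => /row_subPn[i]; rewrite row_mul row_row_mx.
  rewrite row0 row1 => nWh; set v := row_mx _ _ *m _ in nWh.
  exists (lsubmx v), (rsubmx v); rewrite hsubmxK; split.
    by rewrite -(sub_right_block _ (rsubmx v)) hsubmxK.
  rewrite -[v]/(row_action L _ h) orbit_actr; last exact: Hh.
  by apply: Oact (orbit_refl _ _ _); rewrite ?(negPf nzw0) ?(negPf (delta_neq0 _)).
set O0 := O (row_mx u0 0) in Ou1 *.
have Ow0 : row_mx 0 w0 \in O0.
  have [u1_0 | nzu1] := eqVneq u1 0.
    by apply: Oact Ou1; rewrite ?u1_0 // (negPf nzw0) (negPf nzw1).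
  have : row_mx u2 w2 \in O0.
    have [-> | nzw2] := eqVneq w2 0.
      by apply: Oact (orbit_refl _ _ _); rewrite ?(negPf nzu0) ?(negPf nzu2).
    by apply: Oact Ou1; rewrite ?(negPf nzu1) ?(negPf nzu2) ?(negPf nzw1) ?(negPf nzw2).
  rewrite /O0 /O => /orbit_eqP <-; have /orbit_eqP-> := Ow2.
  exact: orbit_refl.
have O_left (u : 'rV_k) : u != 0 -> row_mx u (0 : 'rV_l) \in O0.
  by move=> nzu; apply: Oact (orbit_refl _ _ _); rewrite ?(negPf nzu0) ?(negPf nzu).
have O_right (w : 'rV_l) : w != 0 -> row_mx (0 : 'rV_k) w \in O0.
  by move=> nzw; apply: Oact Ow0; rewrite ?(negPf nzw0) ?(negPf nzw).
have O_neq0 v : v \in O0 -> v != 0.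
  case/orbitP=> h _ <-; rewrite /= /rowact.
  rewrite -(mul0mx _ (mx h)) (inj_eq (row_free_inj (mx_free h))).
  by apply: contraNneq nzu0 => /(congr1 lsubmx); rewrite row_mxKl raddf0 => ->.
have dvO : (#|O0| %| #|H|)%N by apply: dvdn_orbit.
have [/existsP[u3 /existsP[w3 /and3P[nzu3 nzw3 O3]]] | no_mixed] :=
    boolP [exists u : 'rV_k, exists w : 'rV_l,
      [&& u != 0, w != 0 & row_mx u w \in O0]].
  have -> : (3 ^ (k + l) - 1 = #|O0|)%N; last exact: dvO.
  have -> : O0 = [set~ 0].
    apply/setP=> v; rewrite !inE; apply/idP/idP=> [/O_neq0 // | ].
    rewrite -[v]hsubmxK; set u := lsubmx v; set w := rsubmx v.
    have [-> | nzu] := eqVneq u 0; have [-> | nzw] := eqVneq w 0.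
    - by rewrite row_mx0 => /eqP.
    - by move=> _; apply: O_right.
    - by move=> _; apply: O_left.
    by move=> _; apply: Oact O3; rewrite ?(negPf nzu) ?(negPf nzu3)
      ?(negPf nzw) ?(negPf nzw3).
  by rewrite cardsC1 card_mx card_ord mul1n subn1.
case/negP: ndvd; have -> : (3 ^ k + 3 ^ l - 2 = #|O0|)%N; last exact: dvO.
have -> : O0 = (rowg U :|: rowg W) :\ 0.
  apply/setP=> v; rewrite in_setD1 in_setU !mem_rowg -[v]hsubmxK.
  set u := lsubmx v; set w := rsubmx v; rewrite sub_left_block sub_right_block.
  apply/idP/andP=> [Ov | [nzv]].
    split; first exact: O_neq0.
    apply: contraNT no_mixed; rewrite negb_or => /andP[nzw nzu].
    by apply/existsP; exists u; apply/existsP; exists w; rewrite nzu nzw.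
  case/orP=> /eqP e0; rewrite e0 in nzv *.
    by apply: O_left; apply: contraNneq nzv => ->; rewrite row_mx0.
  by apply: O_right; apply: contraNneq nzv => ->; rewrite row_mx0.
have UW0 : rowg U :&: rowg W = [set 0].
  apply/setP=> v; rewrite in_setI !mem_rowg -[v]hsubmxK sub_left_block sub_right_block.
  rewrite inE; apply/andP/eqP=> [[/eqP-> /eqP->] | e]; first exact: row_mx0.
  split; apply/eqP; last by have := congr1 lsubmx e; rewrite row_mxKl raddf0.
  by have := congr1 rsubmx e; rewrite row_mxKr raddf0.
have card_UW : (#|rowg U :|: rowg W| = 3 ^ k + 3 ^ l - 1)%N.
  rewrite cardsU UW0 cards1 !card_rowg rank_left_block rank_right_block.
  by rewrite card_ord.
have := cardsD1 0 (rowg U :|: rowg W).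
rewrite card_UW in_setU mem_rowg sub0mx orTb add1n => eq_c.
by apply: succn_inj; rewrite -eq_c; move: eq_c; clear; lia.
Qed.

End TwoBlocks.

Section TwoBlockElement.

Local Open Scope ring_scope.
Local Notation F := 'F_3.

(** The element x is the sum of a Singer cycle s of the first block and of
    r = eps t, where t is a Singer cycle of the second block and the sign eps is
    chosen so that x has determinant 1; this is possible because the second
    block has odd size. The hypotheses on a and b give s^(p a) = -1 and
    r^(p a) = - t, so that - x^(p a) is the identity on the first block and t on
    the second. Its powers and those of x reach all pairs of vectors. *)
Lemma two_block_element k l (L : linear_group F (k.+1 + l.+1)) (a b : nat)
    (p := (3 ^ k.+1).-1./2) (q := (3 ^ l.+1).-1./2) :
    odd l.+1 -> odd a -> odd b -> ~~ odd (p * a) -> (p * a = 1 + q * b)%N ->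
  exists x : L, [/\ x \in specg L, ~~ odd #[x]%g
    & forall z : L, mx z = (-1)%:M -> two_block (<<[set x; z]>>%G : {group L})].
Proof.
move=> odd_l odd_a odd_b even_e def_e.
have [s [s_trans s_p]] := singer_exists k.
have [t [t_trans t_q]] := singer_exists l.
rewrite -/p in s_p; rewrite -/q in t_q.
have unit_pow n (r : 'M[F]_n.+1) m : r ^+ m = -1 -> r \is a GRing.unit.
  case: m => [|m] r_m; last first.
    by rewrite -(@unitrX_pos _ r m.+1) // r_m unitrN1.
  by move: r_m => /matrixP/(_ 0 0)/eqP; rewrite expr0 !mxE.
have us := unit_pow _ _ _ s_p; have ut := unit_pow _ _ _ t_q.
have det_pm n (r : 'M[F]_n.+1) : r \is a GRing.unit -> \det r = 1 \/ \det r = -1.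
  rewrite -[_ \is a _]/(r \in unitmx) unitmxE.
  by case: (F3_cases (\det r)) => ->; [rewrite unitr0 | left | right].
have [eps [pm_eps det_eps]] : exists eps : F, (eps = 1 \/ eps = -1)
    /\ \det s * \det (eps *: t) = 1.
  have detN : \det (-1 *: t) = - \det t.
    by rewrite detZ -signr_odd odd_l expr1 mulN1r.
  have [s1|s1] := det_pm _ _ us; have [t1|t1] := det_pm _ _ ut.
  - by exists 1; rewrite scale1r s1 t1 mulr1; split; first by left.
  - by exists (-1); rewrite detN s1 t1 opprK mulr1; split; first by right.
  - by exists (-1); rewrite detN s1 t1 mulrNN mulr1; split; first by right.
  - by exists 1; rewrite scale1r s1 t1 mulrNN mulr1; split; first by left.
pose r := eps *: t.
have ur : r \is a GRing.unit.
  by rewrite /r; case: pm_eps => ->; rewrite ?scale1r ?scaleN1r ?unitrN.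
pose X : 'M[F]_(k.+1 + l.+1) := block_mx s 0 0 r.
have detX : \det X = 1 by rewrite det_ublock.
have [|x def_x] := @mx_onto _ _ L X; first by rewrite unitmxE detX unitr1.
have mxX i : mx (x ^+ i)%g = block_mx (s ^+ i) 0 0 (r ^+ i).
  elim: i => [|i IHi]; first by rewrite mx1 !expr0 -scalar_mx_block.
  rewrite expgSr mxM IHi def_x mulmx_block !mulmx0 !mul0mx !addr0 !add0r.
  by rewrite !exprSr.
have sE : s ^+ (p * a) = -1 by rewrite exprM s_p -signr_odd odd_a expr1.
have rE : r ^+ (p * a) = - t.
  have -> : r ^+ (p * a) = eps ^+ (p * a) *: t ^+ (p * a) by rewrite exprZn.
  have -> : eps ^+ (p * a) = 1.
    by case: pm_eps => ->; rewrite ?expr1n // -signr_odd (negPf even_e) expr0.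
  rewrite def_e exprD expr1 exprM t_q -[(-1) ^+ b]signr_odd odd_b expr1.
  by rewrite mulrN1 scale1r.
exists x; split; first by rewrite inE def_x detX.
  apply/negP=> odd_x; have := mxX #[x]%g; rewrite expg_order mx1 scalar_mx_block.
  case/eq_block_mx=> s1 _ _ _.
  have : (s ^+ p) ^+ #[x]%g = 1 by rewrite -exprM mulnC exprM -s1 expr1n.
  rewrite s_p -signr_odd odd_x expr1 => /matrixP/(_ 0 0)/eqP.
  by rewrite !mxE.
move=> z def_z u u' w w' eu ew; set D := <<_>>%G.
have Dx : x \in D by rewrite mem_gen ?inE ?eqxx.
have Dz : z \in D by rewrite mem_gen ?inE ?eqxx ?orbT.
pose B := (z * x ^+ (p * a))%g.
have DB : B \in D by rewrite groupM ?groupX.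
have mxB : mx B = block_mx 1%:M 0 0 t.
  rewrite mxM def_z mxX sE rE mul_scalar_mx scale_block_mx !scaler0 !scaleN1r.
  by rewrite !opprK.
have mxBX i : mx (B ^+ i)%g = block_mx 1%:M 0 0 (t ^+ i).
  elim: i => [|i IHi]; first by rewrite mx1 expr0 -scalar_mx_block.
  rewrite expgSr mxM IHi mxB mulmx_block !mulmx0 !mul0mx !addr0 !add0r mulmx1.
  by rewrite exprSr.
have [i us_i] : exists i, u *m s ^+ i = u'.
  have [u0 | nzu] := eqVneq u 0.
    by exists 0%N; rewrite expr0 mulmx1 u0; apply/esym/eqP; rewrite -eu u0 eqxx.
  by apply: s_trans; rewrite // -eu.
have ewr : (w *m r ^+ i == 0) = (w' == 0).
  have free_r : row_free (r ^+ i) by rewrite row_free_unit; apply: unitrX.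
  rewrite -ew; apply/eqP/eqP=> [e0 | ->]; last exact: mul0mx.
  by apply: (row_free_inj free_r); rewrite e0 mul0mx.
have [j ut_j] : exists j, w *m r ^+ i *m t ^+ j = w'.
  have [w0 | nzw] := eqVneq (w *m r ^+ i) 0.
    by exists 0%N; rewrite expr0 mulmx1 w0; apply/esym/eqP; rewrite -ewr w0 eqxx.
  by apply: t_trans; rewrite // -ewr.
exists (x ^+ i * B ^+ j)%g; first by rewrite groupM ?groupX.
rewrite mxM mxX mxBX mulmxA !mul_row_block !mulmx0 !addr0 !add0r mulmx1.
by rewrite us_i ut_j.
Qed.

End TwoBlockElement.

(** * Stabilisers of subspaces *)
Section StabiliserIndex.

Local Open Scope ring_scope.
Local Notation F := 'F_3.

(** The stabiliser consists of the invertible block triangular matrices. *)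
Lemma card_stab_left_block k l (L : linear_group F (k + l)) :
  #|stab L (left_block k l)|
    = (#|[set A : 'M[F]_k | A \in unitmx]| * 3 ^ (l * k)
       * #|[set A : 'M[F]_l | A \in unitmx]|)%N.
Proof.
pose f (g : L) := (ulsubmx (mx g), dlsubmx (mx g), drsubmx (mx g)).
have ur0 (g : L) : g \in stab L (left_block k l) -> ursubmx (mx g) = 0.
  rewrite inE -[mx g]submxK mul_row_block !mul1mx !mul0mx !addr0 block_mxKur.
  by case/submxP=> B; rewrite mul_mx_row mulmx0 => /eq_row_mx[].
have inj_f : {in stab L (left_block k l) &, injective f}.
  move=> g h /ur0 g0 /ur0 h0 [e1 e2 e3]; apply: mx_inj.
  by rewrite -[mx g]submxK -[mx h]submxK g0 h0 e1 e2 e3.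
rewrite -(card_in_imset inj_f).
have -> : (3 ^ (l * k) = #|[set: 'M[F]_(l, k)]|)%N.
  by rewrite cardsT card_mx card_ord.
rewrite -!cardsX; apply: eq_card => [[[A C] D]]; rewrite !inE /= andbT.
apply/imsetP/andP=> [[g Sg [-> _ ->]] | [uA uD]].
  have := mx_unit g; rewrite -[mx g]submxK ur0 // !unitmxE det_lblock.
  by rewrite block_mxKul block_mxKdr unitrM => /andP.
have [|g def_g] := @mx_onto _ _ L (block_mx A 0 C D).
  by rewrite unitmxE det_lblock unitrM -!unitmxE uA.
exists g; last by rewrite /f def_g block_mxKul block_mxKdl block_mxKdr.
rewrite inE def_g mul_row_block !mul1mx !mul0mx !addr0.
by apply/submxP; exists A; rewrite mul_mx_row mulmx1 mulmx0.
Qed.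

(** A completed row echelon basis of Y extends a basis of Y to the whole space. *)
Lemma eqmx_left_block k l (L : linear_group F (k + l)) m (Y : 'M[F]_(m, k + l)) :
  \rank Y = k -> exists g : L, (Y :=: left_block k l *m mx g)%MS.
Proof.
move=> rY; have [g def_g] := @mx_onto _ _ L _ (row_ebase_unit Y).
exists g; rewrite def_g; have := eq_row_base Y; rewrite /row_base rY pid_mx_row.
by move=> eqY; apply: eqmx_sym.
Qed.

Variable L : linear_group F 5.
Local Notation G := (specg_group L).

Lemma card_L53 : #|L| = (2 * #|G|)%N.
Proof. by have := card_SL_cap (in_setT (neg1 L)); rewrite setTI cardsT. Qed.

(** -1 stabilises every subspace. *)
Lemma index_stab m (Y : 'M[F]_(m, 5)) :
  #|G : G :&: stab L Y| = #|[set: L] : stab L Y|.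
Proof.
rewrite -!divgS ?subsetIl ?subsetT // cardsT card_L53.
by rewrite (card_SL_cap (neg1_stab L Y)) divnMl // setIC.
Qed.

Lemma card_unitmx1 : #|[set A : 'M[F]_1 | A \in unitmx]| = 2%N.
Proof. by rewrite card_unitmx card_ord big_nat1. Qed.

Lemma card_unitmx2 : #|[set A : 'M[F]_2 | A \in unitmx]| = (3 * (2 * 8))%N.
Proof. by rewrite card_unitmx card_ord; do 2![rewrite big_ltn //]; rewrite big_geq. Qed.

Lemma card_unitmx3 : #|[set A : 'M[F]_3 | A \in unitmx]| = (3 ^ 3 * (2 * 8 * 26))%N.
Proof.
rewrite card_unitmx; have -> : #|F| = 3 by rewrite card_ord.
have -> : 'C(3, 2) = 3 by [].
by do 3![rewrite big_ltn; last by []]; rewrite big_geq; last by []; lia.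
Qed.

Lemma card_unitmx4 :
  #|[set A : 'M[F]_4 | A \in unitmx]| = (3 ^ 6 * (2 * 8 * 26 * 80))%N.
Proof.
rewrite card_unitmx; have -> : #|F| = 3 by rewrite card_ord.
have -> : 'C(4, 2) = 6 by [].
do 4![rewrite big_ltn; last by []]; rewrite big_geq; last by []; lia.
Qed.

(** Points and hyperplanes are 121 in number, lines and planes 1210: the
    stabilisers are conjugate to those of blocks. *)
Lemma index_stab_rank m (Y : 'M[F]_(m, 5)) :
    [/\ \rank Y = 1%N -> #|G : G :&: stab L Y| = 121,
        \rank Y = 4 -> #|G : G :&: stab L Y| = 121,
        \rank Y = 2 -> #|G : G :&: stab L Y| = (10 * 121)%N
      & \rank Y = 3 -> #|G : G :&: stab L Y| = (10 * 121)%N].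
Proof.
have cardI : (#|stab L Y| * #|G : G :&: stab L Y|
               = 2 * (11 ^ 2 * (2 ^ 9 * 3 ^ 10 * 5 * 13)))%N.
  by rewrite index_stab Lagrange ?subsetT // cardsT card_L53 card_SL53.
have cardY k l (M : linear_group F (k + l)) p (Z : 'M[F]_(p, k + l)) :
    \rank Z = k -> #|stab M Z| = #|stab M (left_block k l)|.
  by case/(eqmx_left_block M)=> g eqZ; rewrite (eqmx_stab _ eqZ) stabJ cardJg.
split=> rY; move: cardI.
- rewrite (cardY 1 4 L _ Y rY) (card_stab_left_block (k := 1) (l := 4)).
  by rewrite card_unitmx1 card_unitmx4; move: #|_ : _|; clear; lia.
- rewrite (cardY 4 1 L _ Y rY) (card_stab_left_block (k := 4) (l := 1)).
  by rewrite card_unitmx1 card_unitmx4; move: #|_ : _|; clear; lia.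
- rewrite (cardY 2 3 L _ Y rY) (card_stab_left_block (k := 2) (l := 3)).
  by rewrite card_unitmx2 card_unitmx3; move: #|_ : _|; clear; lia.
rewrite (cardY 3 2 L _ Y rY) (card_stab_left_block (k := 3) (l := 2)).
by rewrite card_unitmx2 card_unitmx3; move: #|_ : _|; clear; lia.
Qed.

End StabiliserIndex.

(** * Elements with few overgroups *)
Section Separators.

Local Notation F := 'F_3.
Variable L : linear_group F 5.
Local Notation G := (specg_group L).
Implicit Types (H P M : {group L}) (g x : L).

(** The normalisers of Sylow 11-subgroups have odd order 605. *)
Lemma dvd121_even_full H x :
  H \subset G -> 121 %| #|H| -> x \in H -> ~~ odd #[x] -> H :=: G.
Proof.
move=> sHG dvH Hx even_x.
have [P sylP] := Sylow_exists 11 H; have sPH := pHall_sub sylP.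
have [Q sylQ] := Sylow_exists 11 G.
have cardP : #|P| = (11 ^ 2)%N.
  apply/eqP; rewrite eqn_dvd (card_Hall sylP) -{1}(card_Sylow11 sylQ) (card_Hall sylQ).
  rewrite partn_dvd ?cardG_gt0 ?cardSg //=.
  by rewrite -[X in X %| _](@part_pnat_id 11) ?pnatX // partn_dvd ?cardG_gt0.
have sylPG : 11.-Sylow(G) P.
  rewrite pHallE (subset_trans sPH sHG) cardP -(card_Sylow11 sylQ).
  by rewrite (card_Hall sylQ) /=.
have [nPH | //] := over_Sylow11 sylPG sPH sHG.
case/negP: even_x; have : #[x] %| 605.
  have [cardN _] := card_norm_Sylow11 sylPG.
  by rewrite -[605]/(11 ^ 2 * 5)%N -cardN order_dvdG // inE
    (subsetP sHG) //= (subsetP nPH).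
by move=> dv_x; apply: dvdn_odd dv_x _.
Qed.

(** The elements x whose proper overgroups are confined to the stabilisers of
    two complementary subspaces, the only ones that x stabilises. *)
Definition block_element k l x :=
  exists (U : 'M[F]_(k, 5)) (W : 'M[F]_(l, 5)),
  [/\ \rank U = k, \rank W = l,
      forall m (Y : 'M[F]_(m, 5)), x \in stab L Y ->
        [\/ \rank Y = 0, (Y :=: U)%MS, (Y :=: W)%MS | \rank Y = 5]
    & forall H, H \proper G -> x \in H -> H \subset stab L U \/ H \subset stab L W].

(** The group generated by x and -1 is needed for transitivity on the blocks,
    but it is not in G; an overgroup H of x is therefore enlarged by -1, which
    at most doubles its order. The prime r excludes that N, the number of
    nonzero vectors of the two blocks, divides the order of GL_5(3). *)
Lemma block_element_intro k l x (U : 'M[F]_(k, 5)) (W : 'M[F]_(l, 5)) N r :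
    x \in G -> ~~ odd #[x] -> \rank U = k -> \rank W = l ->
    (forall m (Y : 'M[F]_(m, 5)), <<[set x; neg1 L]>> \subset stab L Y ->
        [\/ \rank Y = 0, (Y :=: U)%MS, (Y :=: W)%MS | \rank Y = 5]) ->
    (forall H, <<[set x; neg1 L]>> \subset H ->
       ~~ (H \subset stab L U) -> ~~ (H \subset stab L W) -> ~~ (N %| #|H|) ->
       242 %| #|H|) ->
    r %| N -> ~~ (r %| 2 * (11 ^ 2 * (2 ^ 9 * 3 ^ 10 * 5 * 13)))%N ->
  block_element k l x.
Proof.
move=> Gx even_x rU rW subD transD dv_r ndv_r; exists U, W; split=> //.
  move=> m Y Yx; apply: subD; rewrite gen_subG; apply/subsetP=> g.
  by case/set2P=> ->; [exact: Yx | exact: neg1_stab].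
move=> H ltHG Hx; apply/orP; apply: contraT; rewrite negb_or => /andP[nHU nHW].
have sHG := proper_sub ltHG; pose K := (H <*> <[neg1 L]>)%G.
have sHK : H \subset K := joing_subl _ _.
have Kz : neg1 L \in K by rewrite mem_gen // inE cycle_id orbT.
have dvK : 242 %| #|K|.
  apply: transD.
  - rewrite gen_subG; apply/subsetP=> g; rewrite !inE => /orP[] /eqP-> //.
    exact: (subsetP sHK).
  - by apply: contra nHU; apply: subset_trans.
  - by apply: contra nHW; apply: subset_trans.
  apply: contra ndv_r => dvN; rewrite -(card_SL53 L) -card_L53 -cardsT.
  by apply: dvdn_trans dv_r (dvdn_trans dvN (cardSg (subsetT _))).
have cHz : <[neg1 L]> \subset 'C(H).
  by rewrite cycle_subG; apply/centP=> h _; apply: neg1_central.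
have dv_K : #|K| %| #|H| * 2.
  have := mul_cardG H <[neg1 L]>; rewrite -orderE neg1_order /= cent_joinEr // => ->.
  exact: dvdn_mulr.
have dvH : 121 %| #|H|.
  by rewrite -(@dvdn_pmul2r 2) //; apply: dvdn_trans dvK dv_K.
have eqHG := dvd121_even_full sHG dvH Hx even_x.
by rewrite eqHG properxx in ltHG.
Qed.

(** The exponents satisfy 40 * 1 = 1 + 1 * 39, where 40 and 1 are half the
    orders of the two Singer cycles. The two blocks contain 80 + 2 = 82 nonzero
    vectors, and 41 does not divide the order of GL_5(3). *)
Lemma block_element41 : exists2 x, x \in G & block_element 4 1 x.
Proof.
have [||||| x [Gx even_x trD]] := @two_block_element 3 0 L 1 39; try by [].
have {}trD := trD _ (neg1E L).
exists x; first exact: Gx.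
apply: (@block_element_intro 4 1 x (left_block 4 1) (right_block 4 1) 82 41).
- exact: Gx.
- exact: even_x.
- exact: (@rank_left_block 4 1).
- exact: (@rank_right_block 4 1).
- by move=> m Y; apply: (@two_block_subspace 4 1 L _ m Y trD).
- by move=> H sDH nHU nHW; apply: (@two_block_transitive 4 1 L _ H trD).
- by [].
by clear; rewrite !(Euclid_dvdM _ _ (isT : prime 41)).
Qed.

(** The exponents satisfy 4 * 23 = 1 + 13 * 7, where 4 and 13 are half the
    orders of the two Singer cycles. The two blocks contain 8 + 26 = 34 nonzero
    vectors, and 17 does not divide the order of GL_5(3). *)
Lemma block_element23 : exists2 x, x \in G & block_element 2 3 x.
Proof.
have [||||| x [Gx even_x trD]] := @two_block_element 1 2 L 23 7; try by [].
have {}trD := trD _ (neg1E L).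
exists x; first exact: Gx.
apply: (@block_element_intro 2 3 x (left_block 2 3) (right_block 2 3) 34 17).
- exact: Gx.
- exact: even_x.
- exact: (@rank_left_block 2 3).
- exact: (@rank_right_block 2 3).
- by move=> m Y; apply: (@two_block_subspace 2 3 L _ m Y trD).
- by move=> H sDH nHU nHW; apply: (@two_block_transitive 2 3 L _ H trD).
- by [].
by clear; rewrite !(Euclid_dvdM _ _ (isT : prime 17)).
Qed.

End Separators.

(** * The covering number *)
Section ConjugateSet.

Variables (gT : finGroupType) (G M : {group gT}).
Hypothesis sMG : M \subset G.

Definition conjugate_set : {set {group gT}} := [set (M :^ g)%G | g in G].

Lemma card_conjugate_set : #|conjugate_set| <= #|G : M|.
Proof.
apply: leq_trans (leq_imset_card (fun c : {set gT} => (M :^ repr c)%G) _).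
apply/subset_leq_card/subsetP=> _ /imsetP[g Gg ->].
apply/imsetP; exists (M :* g); first by rewrite mem_rcosets mulSGid.
apply: val_inj; rewrite /=; case: repr_rcosetP => m Mm.
by rewrite conjsgM (conjGid Mm).
Qed.

Lemma conjugate_set_proper H : 1 < #|G : M| -> H \in conjugate_set -> H \proper G.
Proof.
move=> ind_gt1 /imsetP[g Gg ->]; rewrite -(conjGid Gg) /= properJ properE sMG /=.
by rewrite -indexg_gt1.
Qed.

End ConjugateSet.

Section CoveringNumber.

Local Notation F := 'F_3.
Variable L : linear_group F 5.
Local Notation G := (specg_group L).
Implicit Types (H P M : {group L}) (g x : L).

(** If an element that maps the block to Y does not have determinant 1, then its
    product with z does, and z is scalar. *)
Lemma left_block_conj k l (M : linear_group F (k + l)) m (Y : 'M[F]_(m, k + l)) z :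
    mx z = (-1)%:M%R -> (forall h : M, (h \in specg M) || (z * h \in specg M)) ->
  \rank Y = k -> exists2 h, h \in specg M & stab M Y = stab M (left_block k l) :^ h.
Proof.
move=> def_z spec /(eqmx_left_block M)[h eqY].
have /orP[Gh|Gzh] := spec h.
  by exists h => //; rewrite (eqmx_stab _ eqY) stabJ.
exists (z * h) => //; rewrite conjsgM.
have /normP-> : z \in 'N(stab M (left_block k l)).
  apply: (subsetP (normG [group of stab M (left_block k l)])).
  by rewrite inE def_z mul_mx_scalar scalemx_sub.
by rewrite (eqmx_stab _ eqY) stabJ.
Qed.

Lemma prime_order_in_cycle g (p : nat) : prime p -> p %| #[g] ->
  exists2 r, r \in <[g]> & #[r] = p.
Proof. by move=> pr_p; rewrite orderE => /Cauchy[] // r; exists r. Qed.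

Lemma cycle_stab_fix g r : r \in <[g]> -> g \in stab L (fixmx <[r]>).
Proof.
move=> gr; apply: (subsetP (fixmx_stab _)); apply: (subsetP (cent_sub _)).
rewrite cent_cycle; apply/cent1P; case/cycleP: gr => i ->.
by apply: commuteX; apply: commute_refl.
Qed.

(** The element g stabilises the fixed space of each power of itself: this
    settles the cases of elements r of order 13 and 5, with fixed spaces of
    ranks 2 and 1. If r has order 3, then g stabilises the kernel and the image
    of r - 1, whose ranks are positive and add up to 5, so that one of them has
    rank 1 or 2. *)
Lemma element_types g : g \in G ->
  [\/ exists2 P : {group L}, 11.-Sylow(G) P & g \in 'N_G(P),
      exists m, exists2 Y : 'M[F]_(m, 5), \rank Y = 1%N & g \in stab L Y
    | exists m, exists2 Y : 'M[F]_(m, 5), \rank Y = 2 & g \in stab L Y].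
Proof.
move=> Gg.
have pr_elt (p : nat) r : prime p -> #[r] = p -> p.-group <[r]> /\ <[r]> != 1 :> {set L}.
  move=> pr_p or; rewrite /pgroup -orderE or pnat_id //; split=> //.
  by rewrite -cardG_gt1 -orderE or prime_gt1.
have sgG : <[g]> \subset G by rewrite cycle_subG.
have srg (r : L) : r \in <[g]> -> <[r]> \subset <[g]> by rewrite cycle_subG.
have [/(prime_order_in_cycle (isT : prime 11))[r gr or] | n11] := boolP (11 %| #[g]).
  constructor 1; have [pr ntr] := pr_elt 11 r isT or.
  have [P sylP srP] := Sylow_superset (subset_trans (srg r gr) sgG) pr.
  exists P; first exact: sylP.
  have Pg : g \in P.
    rewrite -(cent_Sylow11 sylP srP ntr) inE Gg /=.
    by apply: (subsetP (sub_abelian_cent (cycle_abelian g) (srg r gr))); apply: cycle_id.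
  by rewrite inE Gg (subsetP (normG P)).
have [/(prime_order_in_cycle (isT : prime 13))[r gr or] | n13] := boolP (13 %| #[g]).
  constructor 3; have [pr ntr] := pr_elt 13 r isT or.
  by exists 5, (fixmx <[r]>); [exact: rank_fix13 pr ntr | exact: cycle_stab_fix].
have [/(prime_order_in_cycle (isT : prime 5))[r gr or] | n5] := boolP (5 %| #[g]).
  constructor 2; have [pr ntr] := pr_elt 5 r isT or.
  by exists 5, (fixmx <[r]>); [exact: rank_fix5 pr ntr | exact: cycle_stab_fix].
have [/(prime_order_in_cycle (isT : prime 3))[r gr or] | n3] := boolP (3 %| #[g]).
  have [pr ntr] := pr_elt 3 r isT or; pose X := (mx r - 1%:M)%R.
  have cgr : (mx g *m X = X *m mx g)%R.
    have c_gr : commute g r by case/cycleP: gr => i ->; apply: commuteX; apply: commute_refl.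
    by rewrite mulmxBr mulmxBl mulmx1 mul1mx -!mxM c_gr.
  have kerX : g \in stab L (kermx X).
    rewrite inE; apply/sub_kermxP.
    by rewrite -mulmxA cgr mulmxA mulmx_ker mul0mx.
  have imX : g \in stab L X by rewrite inE -cgr submxMl.
  have rk : 0 < \rank (kermx X).
    apply: leq_trans (rank_fix3 pr) (mxrankS _).
    by apply/sub_kermxP; rewrite mulmxBr mulmx1 (fixmxP _ _ (submx_refl _)) ?cycle_id ?subrr.
  have rX : 0 < \rank X.
    rewrite lt0n mxrank_eq0; apply: contraNneq ntr => X0.
    rewrite cycle_eq1; apply/eqP/mx_inj; rewrite mx1.
    by apply/eqP; rewrite -subr_eq0; apply/eqP.
  move: rk rX; rewrite mxrank_ker; move: (rank_le5 X).
  case rXE: (\rank X) => [|[|[|[|[|]]]]] //.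
  - by constructor 2; exists 5, X.
  - by constructor 3; exists 5, X.
  - by constructor 3; exists 5, (kermx X); rewrite // mxrank_ker rXE.
  - by constructor 2; exists 5, (kermx X); rewrite // mxrank_ker rXE.
(* Only 2-elements remain; a Sylow 2-subgroup fixes one of the 121 points. *)
constructor 2; have pg : 2.-group <[g]>.
  apply/pgroupP=> p pr_p; rewrite -orderE => dv_p.
  have : p %| 11 ^ 2 * (2 ^ 9 * 3 ^ 10 * 5 * 13).
    by rewrite -(card_SL53 L); apply: dvdn_trans dv_p (order_dvdG Gg).
  rewrite (Euclid_dvdM (11 ^ 2) _ pr_p) (Euclid_dvdM (_ * 5) 13 pr_p).
  rewrite (Euclid_dvdM (_ * 3 ^ 10) 5 pr_p) (Euclid_dvdM (2 ^ 9) (3 ^ 10) pr_p).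
  rewrite !(Euclid_dvdX _ _ pr_p) !andbT !(dvdn_prime2 pr_p) //.
  have not_p q : ~~ (q %| #[g]) -> (p == q) = false.
    by move=> nq; apply: contraNF nq => /eqP <-.
  rewrite (not_p 11 n11) (not_p 13 n13) (not_p 5 n5) (not_p 3 n3) !orbF.
  by move/eqP->.
pose U : 'M[F]_(1, 5) := left_block 1 4; pose M := G :&: stab L U.
have rU : \rank U = 1%N := rank_left_block 1 4.
have indM : #|G : M| = 121 by case: (index_stab_rank L U) => ->.
have [S sylS] := Sylow_exists 2 [group of M].
have sylSG : 2.-Sylow(G) S.
  rewrite pHallE (subset_trans (pHall_sub sylS)) ?subsetIl //= (card_Hall sylS).
  rewrite -(Lagrange (subsetIl G (stab L U))) -/M indM partnM ?cardG_gt0 //.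
  by rewrite (@part_p'nat _ 121) ?muln1.
have [T sylT sgT] := Sylow_superset sgG pg.
have [h Gh defT] := Sylow_trans sylSG sylT.
exists 1%N, (U *m mx h)%R; first by rewrite mxrankMfree ?mx_free.
rewrite stabJ; apply: subsetP (cycle_id g).
rewrite (subset_trans sgT) // defT conjSg (subset_trans (pHall_sub sylS)) //.
exact: subsetIr.
Qed.

(** The numbers of conjugates of the normaliser of a Sylow 11-subgroup, of points
    and of subspaces of rank 2. *)
Definition sigma := (2 ^ 9 * 3 ^ 10 * 13 + 121 + 10 * 121)%N.

Lemma cover_exists : exists2 C : {set {group L}}, is_cover G C & #|C| <= sigma.
Proof.
have [P sylP] := Sylow_exists 11 G; have [_ indN] := card_norm_Sylow11 sylP.
pose MA := [group of 'N_G(P)].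
pose M1 := [group of G :&: stab L (left_block 1 4)].
pose M2 := [group of G :&: stab L (left_block 2 3)].
have ind1 : #|G : M1| = 121.
  by case: (index_stab_rank L (left_block 1 4)) => ->; rewrite ?rank_left_block.
have ind2 : #|G : M2| = (10 * 121)%N.
  by case: (index_stab_rank L (left_block 2 3)) => _ _ ->; rewrite ?rank_left_block.
have sub_A : MA \subset G := subsetIl _ _.
have sub_1 : M1 \subset G := subsetIl _ _.
have sub_2 : M2 \subset G := subsetIl _ _.
exists (conjugate_set G MA :|: conjugate_set G M1 :|: conjugate_set G M2); last first.
  apply: leq_trans (leq_card_setU _ _).1 _; apply: leq_add; last first.
    by rewrite -ind2 card_conjugate_set.
  apply: leq_trans (leq_card_setU _ _).1 _; apply: leq_add.
    by rewrite -indN card_conjugate_set.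
  by rewrite -ind1 card_conjugate_set.
have ltA : 1 < #|G : MA|.
  rewrite indN; apply: leq_trans (leq_pmull 13 _); first by [].
  by rewrite muln_gt0 !expn_gt0.
have proper_C H :
    H \in conjugate_set G MA :|: conjugate_set G M1 :|: conjugate_set G M2 ->
    H \proper G.
  rewrite !inE -orbA => /or3P[]; apply: conjugate_set_proper => //.
    by rewrite ind1.
  by rewrite ind2.
split; first exact: proper_C.
have cov (M : {group L}) g h : conjugate_set G M \subset
    conjugate_set G MA :|: conjugate_set G M1 :|: conjugate_set G M2 ->
    h \in G -> g \in M :^ h ->
    g \in \bigcup_(H in conjugate_set G MA
                        :|: conjugate_set G M1 :|: conjugate_set G M2) H.
  move=> sMC Gh Mg; apply/bigcupP; exists (M :^ h)%G => //.
  by apply: (subsetP sMC); apply: imset_f.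
apply/setP/subset_eqP/andP; split.
  by apply/bigcupsP=> H /proper_C/proper_sub.
have spec h : (h \in G) || (neg1 L * h \in G) := SL_neg1 h.
apply/subsetP=> g Gg.
case: (element_types Gg) => [[Q sylQ nQg]|[m [Y rY Yg]]|[m [Y rY Yg]]].
- have [h Gh defQ] := Sylow_trans sylP sylQ; apply: (cov MA g h _ Gh).
    by rewrite -setUA subsetUl.
  by rewrite /= conjIg conjGid // -normJ -defQ.
- have [h Gh stabY] := @left_block_conj 1 4 L m Y _ (neg1E L) spec rY.
  apply: (cov M1 g h _ Gh); first by rewrite setUAC subsetUr.
  by rewrite /= conjIg conjGid // inE Gg -stabY.
have [h Gh stabY] := @left_block_conj 2 3 L m Y _ (neg1E L) spec rY.
apply: (cov M2 g h _ Gh); first by rewrite subsetUr.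
by rewrite /= conjIg conjGid // inE Gg -stabY.
Qed.

Lemma block_element_conj_stab k l x g H :
    block_element k l x -> g \in G -> H \proper G -> x ^ g \in H ->
  exists m, exists2 Y : 'M[F]_(m, 5), \rank Y = k \/ \rank Y = l & H \subset stab L Y.
Proof.
move=> [U [W [rU rW _ over]]] Gg ltHG Hxg.
have [||sHU|sHW] := over (H :^ g^-1)%G.
- by rewrite -(conjGid (groupVr Gg)) /= properJ.
- by rewrite mem_conjgV.
- exists k, (U *m mx g)%R; first by rewrite mxrankMfree ?mx_free //; left.
  by rewrite stabJ -sub_conjgV.
exists l, (W *m mx g)%R; first by rewrite mxrankMfree ?mx_free //; right.
by rewrite stabJ -sub_conjgV.
Qed.

Lemma block_element_conj_rank k l x g m (Y : 'M[F]_(m, 5)) :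
    block_element k l x -> x ^ g \in stab L Y ->
  [\/ \rank Y = 0, \rank Y = k, \rank Y = l | \rank Y = 5].
Proof.
move=> [U [W [rU rW inv _]]]; rewrite -mem_conjgV -stabJ => /inv.
rewrite -(mxrankMfree Y (mx_free g^-1)).
by case=> [r0 | -> | -> | r5];
  [constructor 1 | constructor 2 | constructor 3 | constructor 4].
Qed.

(** M is the stabiliser of the block that H fixes: x stabilises no other
    subspace of the same rank, as k and l are distinct. *)
Lemma block_element_unique_conjugate k l x (m : nat) H :
    0 < k < 5 -> 0 < l < 5 -> k != l ->
    (forall p (Y : 'M[F]_(p, 5)), \rank Y = k \/ \rank Y = l ->
      #|G : G :&: stab L Y| = m) ->
    block_element k l x -> H \proper G -> x \in H ->
  exists M : {group L}, [/\ H \subset M, M \subset G, m <= #|G : M|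
    & {in G, forall g, x \in M :^ g -> g \in M}].
Proof.
move=> /andP[k_gt0 k_lt5] /andP[l_gt0 l_lt5] neq_kl indY.
move=> [U [W [rU rW inv over]]] ltHG Hx.
have uniq p (Y : 'M[F]_(p, 5)) : ((Y :=: U) \/ (Y :=: W))%MS ->
    {in G, forall g, x \in (G :&: stab L Y) :^ g -> g \in G :&: stab L Y}.
  move=> eqY g Gg; rewrite conjIg inE -stabJ => /andP[_ /inv Ygx].
  rewrite inE Gg; apply/stabP.
  have rYg : \rank (Y *m mx g)%R = \rank Y by rewrite mxrankMfree ?mx_free.
  case: eqY Ygx => eqY; rewrite rYg eqY ?rU ?rW.
    case=> [e|eqU|eqW|e].
    - by rewrite e in k_gt0.
    - by apply: eqmx_trans eqU (eqmx_sym eqY).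
    - by case/eqP: neq_kl; rewrite -rU -eqY -rYg eqW rW.
    by rewrite e in k_lt5.
  case=> [e|eqU|eqW|e].
  - by rewrite e in l_gt0.
  - by case/eqP: neq_kl; rewrite -rW -eqY -rYg eqU rU.
  - by apply: eqmx_trans eqW (eqmx_sym eqY).
  by rewrite e in l_lt5.
have sHG := proper_sub ltHG.
have [sHU | sHW] := over H ltHG Hx.
  exists [group of G :&: stab L U]; split; [| exact: subsetIl | |].
  - by rewrite subsetI sHG.
  - by rewrite indY //; left.
  by apply: uniq; left.
exists [group of G :&: stab L W]; split; [| exact: subsetIl | |].
- by rewrite subsetI sHG.
- by rewrite indY //; right.
by apply: uniq; right.
Qed.

(** A member H of the cover that meets the class of a block element fixes a
    subspace of rank k or l; so H contains no element of order 121, and no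
    element of the other block type, which stabilises no subspace of such a
    rank. *)
Lemma cover_lower_bound (C : {set {group L}}) : is_cover G C -> sigma <= #|C|.
Proof.
move=> covC; have [propC _] := covC.
have [P sylP] := Sylow_exists 11 G; have [_ indN] := card_norm_Sylow11 sylP.
have sPG := pHall_sub sylP; have pP := pHall_pgroup sylP.
have /cyclicP[a defP] := cyclic_Sylow11 sylP.
have Ga : a \in G by apply: (subsetP sPG); rewrite defP cycle_id.
have [b Gb block_b] := block_element41 L; have [c Gc block_c] := block_element23 L.
pose meet x := [set H in C | x ^: G :&: H != set0].
have leA : 2 ^ 9 * 3 ^ 10 * 13 <= #|meet a|.
  apply: cover_class_lower_bound => // H ltHG Ha; exists [group of 'N_G(P)].
  have sHG := proper_sub ltHG.
  have sPH : P \subset H by rewrite defP cycle_subG.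
  split.
  - rewrite subsetI sHG; have [//|eqHG] := over_Sylow11 sylP sPH sHG.
    by rewrite eqHG properxx in ltHG.
  - exact: subsetIl.
  - by rewrite -indN.
  move=> g Gg; rewrite /= conjIg conjGid // -normJ => /setIP[_ nPga].
  rewrite inE Gg; apply/normP/eqP; rewrite eq_sym eqEcard cardJg leqnn andbT.
  have sylPg : 11.-Sylow('N_G(P :^ g)) (P :^ g).
    have sPgN : P :^ g \subset 'N_G(P :^ g).
      by rewrite subsetI normG -(conjGid Gg) conjSg sPG.
    by apply: pHall_subl sPgN (subsetIl _ _) _; rewrite pHallJ.
  have sPN : P \subset 'N_G(P :^ g) by rewrite subsetI sPG {1}defP cycle_subG.
  rewrite (sub_normal_Hall sylPg) //.
  by rewrite /normal subsetIr subsetI normG -(conjGid Gg) conjSg sPG.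
have leB : 121 <= #|meet b|.
  apply: cover_class_lower_bound => // H.
  apply: block_element_unique_conjugate block_b => // p Y.
  by case: (index_stab_rank L Y) => r1 r4 _ _ [/r4 | /r1].
have leC : 10 * 121 <= #|meet c|.
  apply: cover_class_lower_bound => // H.
  apply: block_element_unique_conjugate block_c => // p Y.
  by case: (index_stab_rank L Y) => _ _ r2 r3 [/r2 | /r3].
have meetP x H : H \in meet x -> H \proper G /\ exists2 g, g \in G & x ^ g \in H.
  rewrite inE => /andP[/propC ltHG /set0Pn[_ /setIP[/imsetP[g Gg ->] Hxg]]].
  by split=> //; exists g.
have not_a k l x H : 0 < k < 5 -> 0 < l < 5 -> block_element k l x ->
    H \in meet x -> H \in meet a -> False.
  move=> lt_k lt_l block_x /meetP[ltHG [g Gg Hxg]] /meetP[_ [h Gh Hah]].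
  have [m [Y rY sHY]] := block_element_conj_stab block_x Gg ltHG Hxg.
  have sPhY : P :^ h \subset stab L Y.
    by apply: subset_trans sHY; rewrite defP -cycleJ cycle_subG.
  have [||r0|r5] := irr11 (R := (P :^ h)%G) _ _ sPhY.
  - by rewrite /pgroup /= cardJg.
  - by rewrite /= -cardG_gt1 cardJg cardG_gt1 (Sylow11_neq1 sylP).
  - by case: rY => e; rewrite -e r0 in lt_k lt_l.
  by case: rY => e; rewrite -e r5 in lt_k lt_l.
have dAB : meet a :&: meet b = set0.
  apply/setP=> H; rewrite inE in_set0; apply/negP=> /andP[Ha Hb].
  exact: not_a 4 1%N b H isT isT block_b Hb Ha.
have dABC : (meet a :|: meet b) :&: meet c = set0.
  apply/setP=> H; rewrite inE in_set0 in_setU; apply/negP=> /andP[/orP[Ha | Hb] Hc].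
    exact: not_a 2 3 c H isT isT block_c Hc Ha.
  have [ltHG [g Gg Hbg]] := meetP b H Hb; have [_ [h Gh Hch]] := meetP c H Hc.
  have [m [Y rY sHY]] := block_element_conj_stab block_b Gg ltHG Hbg.
  have := block_element_conj_rank block_c (subsetP sHY _ Hch).
  by case: rY => ->; case.
apply: (@leq_trans #|meet a :|: meet b :|: meet c|); last first.
  have sub_C x : meet x \subset C by apply/subsetP=> H; rewrite inE => /andP[].
  by apply: subset_leq_card; rewrite !subUset !sub_C.
rewrite cardsU dABC cards0 subn0 cardsU dAB cards0 subn0.
exact: leq_add (leq_add leA leB) leC.
Qed.

Lemma covering_number_SL : has_covering_number G sigma.
Proof.
split; last exact: cover_lower_bound.
have [C covC le_C] := cover_exists; exists C; split=> //.
by apply/eqP; rewrite eqn_leq le_C cover_lower_bound.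
Qed.

(** The centre lies in all Sylow 11-subgroups, whose intersection is trivial. *)
Lemma center_SL53 : 'Z(G) = 1.
Proof.
have [P sylP] := Sylow_exists 11 G; have [cardN _] := card_norm_Sylow11 sylP.
have sZP (Q : {group L}) : 11.-Sylow(G) Q -> 'Z(G) \subset Q.
  move=> sylQ; rewrite -(cent_Sylow11 sylQ (subxx Q) (Sylow11_neq1 sylQ)).
  by rewrite setIS // centS // (pHall_sub sylQ).
apply/eqP; apply: contraT => ntZ.
suffices sGN : G \subset 'N(P).
  have cardG : #|G| = (11 ^ 2 * 5)%N by rewrite -cardN (setIidPl sGN).
  have : 13 %| 11 ^ 2 * 5.
    by rewrite -cardG card_SL53 mulnA dvdn_mull.
  by rewrite (Euclid_dvdM _ _ (isT : prime 13)).
apply/subsetP=> g Gg; apply/normP/esym.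
have sylPg : 11.-Sylow(G) (P :^ g)%G by rewrite pHallJ.
apply: (TI_Sylow11 sylP sylPg); apply: contraNneq ntZ => tiPg.
by rewrite -subG1 -tiPg subsetI !sZP.
Qed.

End CoveringNumber.

Lemma SL_isog_PSL : SL 5 'F_3 \isog PSL 5 'F_3.
Proof.
apply: quotient_isog; first exact: normal_norm (center_normal _).
have := center_SL53 (GL_linear_group 'F_3 4) => Z1.
have : 'Z(SL 5 'F_3) = 1 by exact: Z1.
by move=> Z1'; apply/trivgP; apply: subset_trans (subsetIl _ _) _; rewrite /= Z1'.
Qed.

(** The numeral 393031475 unfolds to a conversion from decimal digits. It is
    evaluated in Horner form, so that no unary representation of the number is
    built. *)
Lemma sigma_num : sigma = 393031475.
Proof.
unfold Nat.of_num_uint; rewrite DecimalNat.Unsigned.of_uint_alt /sigma.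
cbn [Decimal.rev Decimal.revapp DecimalNat.Unsigned.of_lu].
lia.
Qed.

Theorem mainTheorem3 : has_covering_number (PSL 5 'F_3) 393031475.
Proof.
rewrite -sigma_num; apply: has_covering_number_isog SL_isog_PSL _.
exact: (covering_number_SL (GL_linear_group 'F_3 4)).
Qed.
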